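(* Let $M$ be a complete Riemannian manifold of dimension $m$, $\Phi$ a smooth flow on $M$ with infinitesimal generator $X\in\mathfrak{X}(M)$, and $S\subset M$ an embedded smooth submanifold to which $X$ is nowhere tangent, such that $\mathcal{D}^{(p)}=\mathbb{R}$ for all $p\in S$. Let $E_S$ be a smooth vector subbundle of $\mathrm{T}M|_S$, with fibers $E_p$ ($p\in S$), of rank $m-\dim(S)-1$ such that (a) $\displaystyle\min_{v\in X_p\oplus \mathrm{T}_pS,\ v\neq0}\lambda^+(v)>\max_{u\in E_p}\lambda^+(u)$ for all $p\in S$, and (b) $\displaystyle\max_{v\in X_p\oplus \mathrm{T}_pS}\lambda^-(v)<\min_{u\in E_p,\ u\neq0}\lambda^-(u)$ for all $p\in S$. Then there are two unique continuous and invariant vector subbundles $E,F$ of $\mathrm{T}M|_N$ over the image $N$ of the smooth immersion $\Phi|_{\mathbb{R}\times S}$ with $E|_S=E_S$, $F|_S=\mathrm{T}S\oplus\bigsqcup_{p\in S}\operatorname{span}X_p$, and $E\oplus F=\mathrm{T}M|_N$.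
   Context: $X_p\oplus \mathrm{T}_pS$ denotes the linear subspace $\operatorname{span}(X_p)\oplus \mathrm{T}_pS$ of $\mathrm{T}_pM$. $\mathfrak{X}(M)$ is the space of smooth vector fields on $M$. $\mathcal{D}^{(p)}\subseteq\mathbb{R}$ is the open interval of times $t$ for which $\Phi^t(p)$ is defined. $N=\{\Phi^t(p):t\in\mathbb{R},p\in S\}$. A subbundle of $\mathrm{T}M|_N$ is invariant if $\mathrm{d}\Phi^t$ maps its fiber over $x\in N$ onto its fiber over $\Phi^t(x)$ for all $t\in\mathbb{R}$. Lyapunov exponents (values in $\overline{\mathbb{R}}$): for $0\neq v\in \mathrm{T}_pM$, $0\ne t\in\mathcal{D}^{(p)}$ put $\lambda^t(v)=\frac1{|t|}\log\frac{\|\mathrm{d}\Phi^t(v)\|}{\|v\|}$, and $\lambda^t(0)=-\infty$. Then $\lambda^+(v)=\limsup_{T\to\sup\mathcal{D}^{(p)}}\lambda^T(v)$ and $\lambda^-(v)=\limsup_{T\to\inf\mathcal{D}^{(p)}}\lambda^T(v)$. *)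

(* Defs.v *)
From HB Require Import structures.
From mathcomp Require Import all_boot all_order all_algebra.
From mathcomp Require Import all_classical all_reals all_analysis.
Set Implicit Arguments.
Unset Strict Implicit.
Unset Printing Implicit Defensive.
Import Order.TTheory GRing.Theory Num.Theory.
Import numFieldNormedType.Exports.
Local Open Scope classical_set_scope.
Local Open Scope ring_scope.

(* For [U] open and [V] finite-dimensional, [f] is C^(k+1) on [U]
   iff it is differentiable there and all its directional derivatives are
   C^k. *)
Fixpoint Ck_on (R : realType) (V W : normedModType R) (k : nat) (U : set V)
    (f : V -> W) : Prop :=
  if k is k'.+1 then
    (forall x, U x -> differentiable f x) /\
    (forall v : V, Ck_on k' U (fun x => 'd f x v))
  else forall x, U x -> {for x, continuous f}.

Definition smooth_on (R : realType) (V W : normedModType R) (U : set V)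
    (f : V -> W) : Prop :=
  forall k, Ck_on k U f.

(* [cmap] and [cinv] are total functions; only their values on [cdom] and
   [ccod] are meaningful. *)
Record chart (R : realType) (M : topologicalType) (n : nat) := Chart {
  cdom : set M;
  ccod : set 'rV[R]_n;
  cmap : M -> 'rV[R]_n;
  cinv : 'rV[R]_n -> M;
  cdom_open : open cdom;
  ccod_open : open ccod;
  cmap_cod : forall p, cdom p -> ccod (cmap p);
  cinv_dom : forall x, ccod x -> cdom (cinv x);
  cmapK : forall p, cdom p -> cinv (cmap p) = p;
  cinvK : forall x, ccod x -> cmap (cinv x) = x;
  cmap_continuous : forall p, cdom p -> {for p, continuous cmap};
  cinv_continuous : forall x, ccod x -> {for x, continuous cinv} }.

(* [chart_at p] is a preferred chart around [p]. The tangent space T_pM is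
   represented by 'rV[R]_n, a tangent vector at [p] being given by its
   components in the chart [chart_at p]. *)
Record smooth_manifold (R : realType) (n : nat) := SmoothManifold {
  carrier :> topologicalType;
  carrier_hausdorff : hausdorff_space carrier;
  carrier_second_countable : @second_countable carrier;
  atlas : set (chart R carrier n);
  chart_at : carrier -> chart R carrier n;
  chart_at_atlas : forall p, atlas (chart_at p);
  mem_chart_at : forall p, cdom (chart_at p) p;
  atlas_compatible : forall b c, atlas b -> atlas c ->
    smooth_on (ccod b `&` cinv b @^-1` cdom c) (cmap c \o cinv b) }.

Arguments atlas {R n} M c : rename.

Section Manifolds.
Context {R : realType}.

Definition smooth_into n (M : smooth_manifold R n) (V : normedModType R)
    (U : set V) (f : V -> M) : Prop :=
  (forall x, U x -> {for x, continuous f}) /\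
  (forall c, atlas M c -> smooth_on (U `&` f @^-1` cdom c) (cmap c \o f)).

Definition smooth_map n1 n2 (M1 : smooth_manifold R n1)
    (M2 : smooth_manifold R n2) (f : M1 -> M2) : Prop :=
  forall a, atlas M1 a -> smooth_into (ccod a) (f \o cinv a).

(* The differential V -> T_(f x)M of a map from a normed space to a manifold. *)
Definition diff_into n (M : smooth_manifold R n) (V : normedModType R)
    (f : V -> M) (x : V) : {linear V -> 'rV[R]_n} :=
  'd (cmap (chart_at (f x)) \o f) x.

(* The differential T_pM1 -> T_(f p)M2 of a map between manifolds. *)
Definition mdiff n1 n2 (M1 : smooth_manifold R n1) (M2 : smooth_manifold R n2)
    (f : M1 -> M2) (p : M1) : {linear 'rV[R]_n1 -> 'rV[R]_n2} :=
  diff_into (f \o cinv (chart_at p)) (cmap (chart_at p) p).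

(* The components in the chart [b] of the tangent vector [v] at [p]. *)
Definition tangent_coord n (M : smooth_manifold R n) (b : chart R M n) (p : M)
    (v : 'rV[R]_n) : 'rV[R]_n :=
  'd (cmap b \o cinv (chart_at p)) (cmap (chart_at p) p) v.

(* An embedded submanifold is given by a manifold [S] and a smooth embedding
   [iota], to be thought of as the inclusion of a subset. *)
Record smooth_embedding m d (S : smooth_manifold R d) (M : smooth_manifold R m)
    (iota : S -> M) : Prop := SmoothEmbedding {
  embedding_smooth : smooth_map iota;
  embedding_immersion : forall p, injective (mdiff iota p);
  embedding_injective : injective iota;
  embedding_topology : forall U : set S,
    open U <-> exists2 V : set M, open V & U = iota @^-1` V }.

Definition submanifold_tangent m d (S : smooth_manifold R d)
    (M : smooth_manifold R m) (iota : S -> M) (p : S) : {vspace 'rV[R]_m} :=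
  limg (linfun (mdiff iota p)).

(* In [metric_smooth], [diff_into (cinv c) x] sends a vector to the tangent
   vector at [cinv c x] with these components in the chart [c]. *)
Record riemannian_metric n (M : smooth_manifold R n) := RiemannianMetric {
  metric :> M -> 'rV[R]_n -> 'rV[R]_n -> R;
  metric_linear : forall p u, linear (metric p u : 'rV[R]_n -> R^o);
  metric_symmetric : forall p u v, metric p u v = metric p v u;
  metric_pos : forall p v, v != 0 -> 0 < metric p v v;
  metric_smooth : forall c, atlas M c -> forall u v : 'rV[R]_n,
    smooth_on (ccod c) (fun x => metric (cinv c x)
      (diff_into (M := M) (cinv c) x u)
      (diff_into (M := M) (cinv c) x v) : R^o) }.

Definition tangent_norm n (M : smooth_manifold R n) (g : riemannian_metric M)
    (p : M) (v : 'rV[R]_n) : R :=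
  Num.sqrt (g p v v).

Definition curve_length n (M : smooth_manifold R n) (g : riemannian_metric M)
    (gamma : R^o -> M) : \bar R :=
  (\int[lebesgue_measure]_(t in `[0%R, 1%R])
     (tangent_norm g (gamma t) (diff_into gamma t 1))%:E)%E.

(* [piecewise_smooth_path g p q l]: some piecewise smooth path from [p] to [q],
   its smooth pieces being parametrized by [0, 1], has length [l]. *)
Inductive piecewise_smooth_path n (M : smooth_manifold R n)
    (g : riemannian_metric M) : M -> M -> \bar R -> Prop :=
| path_nil p : piecewise_smooth_path g p p 0%E
| path_cons (gamma : R^o -> M) (U : set R^o) q l :
    open U -> `[0, 1] `<=` U -> smooth_into U gamma ->
    piecewise_smooth_path g (gamma 1) q l ->
    piecewise_smooth_path g (gamma 0) q (curve_length g gamma + l)%E.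

Definition riemannian_distance n (M : smooth_manifold R n)
    (g : riemannian_metric M) (p q : M) : \bar R :=
  ereal_inf [set l | piecewise_smooth_path g p q l].

(* No connectedness is assumed: the distance is +oo between components. *)
Definition riemannian_complete n (M : smooth_manifold R n)
    (g : riemannian_metric M) : Prop :=
  forall u : nat -> M,
    (forall e : R, 0 < e -> exists K : nat, forall i j : nat,
       (K <= i)%N -> (K <= j)%N -> (riemannian_distance g (u i) (u j) < e%:E)%E) ->
    exists p : M, riemannian_distance g (u k) p @[k --> \oo] --> 0%E.

(* [flow_dom p] is the set of times [t] for which [flow_map t p] is defined. The
   equivalence in [flow_domD] says that the domain is the maximal one, i.e. that
   no integral curve can be extended beyond it. *)
Record smooth_flow n (M : smooth_manifold R n) := SmoothFlow {
  flow_dom : M -> set R;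
  flow_map :> R -> M -> M;
  flow_dom_open : open [set z : R * M | flow_dom z.2 z.1];
  flow_dom_interval : forall p, is_interval (flow_dom p);
  flow_dom0 : forall p, flow_dom p 0;
  flow_domD : forall p s t, flow_dom p s ->
    (flow_dom (flow_map s p) t <-> flow_dom p (t + s));
  flow0 : forall p, flow_map 0 p = p;
  flowD : forall p s t, flow_dom p s -> flow_dom (flow_map s p) t ->
    flow_map t (flow_map s p) = flow_map (t + s) p;
  flow_smooth : forall a, atlas M a ->
    smooth_into (V := (R^o * 'rV[R]_n)%type)
      [set z | ccod a z.2 /\ flow_dom (cinv a z.2) z.1]
      (fun z => flow_map z.1 (cinv a z.2)) }.

Definition generator n (M : smooth_manifold R n) (Phi : smooth_flow M) (p : M) :
    'rV[R]_n :=
  diff_into (fun t : R^o => Phi t p) 0 1.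

Definition finite_time_exponent n (M : smooth_manifold R n)
    (g : riemannian_metric M) (Phi : smooth_flow M) (t : R) (p : M)
    (v : 'rV[R]_n) : \bar R :=
  if v == 0 then -oo%E
  else (`|t|^-1 * ln (tangent_norm g (Phi t p) (mdiff (Phi t) p v)
                      / tangent_norm g p v))%:E.

(* The filters "t -> sup D" and "t -> inf D" for an open interval [D]. *)
Definition to_sup (D : set R) : set_system R :=
  filter_from D (fun a => [set t | D t /\ a < t]).
Definition to_inf (D : set R) : set_system R :=
  filter_from D (fun a => [set t | D t /\ t < a]).

Definition forward_exponent n (M : smooth_manifold R n)
    (g : riemannian_metric M) (Phi : smooth_flow M) (p : M) (v : 'rV[R]_n) :
    \bar R :=
  limf_esup (fun t => finite_time_exponent g Phi t p v)
    (to_sup (flow_dom Phi p)).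

Definition backward_exponent n (M : smooth_manifold R n)
    (g : riemannian_metric M) (Phi : smooth_flow M) (p : M) (v : 'rV[R]_n) :
    \bar R :=
  limf_esup (fun t => finite_time_exponent g Phi t p v)
    (to_inf (flow_dom Phi p)).

(* A local frame of [E] consists of [k] local sections of TM along [S], i.e.
   smooth maps q |-> (iota q, sigma i q). *)
Definition smooth_subbundle m d (S : smooth_manifold R d)
    (M : smooth_manifold R m) (iota : S -> M) (k : nat)
    (E : S -> {vspace 'rV[R]_m}) : Prop :=
  forall p : S, exists (U : set S) (sigma : 'I_k -> S -> 'rV[R]_m),
    [/\ open U, U p,
        forall q, U q -> basis_of (E q) [tuple sigma i q | i < k] &
        forall i a b, atlas S a -> atlas M b ->
          smooth_on
            (ccod a `&` [set x | U (cinv a x) /\ cdom b (iota (cinv a x))])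
            (fun x => tangent_coord (M := M) b (iota (cinv a x))
                        (sigma i (cinv a x)))].

(* The image [range j] of a map [j] carries the topology coinduced by [j]: a set
   [W] is open iff [j @^-1` W] is, and a function on [W] is continuous iff its
   composite with [j] is. For a possibly non-injective immersion [j] this is
   finer than the topology induced from [M] in general. The values of [E]
   outside [range j] are irrelevant. *)
Definition continuous_subbundle (Y : topologicalType) m
    (M : smooth_manifold R m) (j : Y -> M) (k : nat)
    (E : M -> {vspace 'rV[R]_m}) : Prop :=
  forall x, range j x ->
    exists (W : set M) (sigma : 'I_k -> M -> 'rV[R]_m),
      [/\ W `<=` range j, open (j @^-1` W), W x,
          forall y, W y -> basis_of (E y) [tuple sigma i y | i < k] &
          forall i b, atlas M b ->
            forall z, (j @^-1` (W `&` cdom b)) z ->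
              {for z, continuous
                (fun z' => tangent_coord (M := M) b (j z') (sigma i (j z')))}].

Section Flowout.
Context m d (M : smooth_manifold R m) (S : smooth_manifold R d).
Variables (Phi : smooth_flow M) (iota : S -> M).

(* The restriction of the flow to R x S; its range is N. *)
Definition flowout (z : R * S) : M := Phi z.1 (iota z.2).

Definition flowout_immersion : Prop :=
  (forall a, atlas S a ->
     smooth_into (V := (R^o * 'rV[R]_d)%type) [set z | ccod a z.2]
       (fun z => flowout (z.1, cinv a z.2))) /\
  (forall (t : R) (p : S),
     injective (diff_into (V := (R^o * 'rV[R]_d)%type)
       (fun z => flowout (z.1, cinv (chart_at p) z.2))
       (t, cmap (chart_at p) p))).

Definition invariant_subbundle (E : M -> {vspace 'rV[R]_m}) : Prop :=
  forall x t, range flowout x ->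
    (linfun (mdiff (Phi t) x) @: E x)%VS = E (Phi t x).

(* span X_p + T_pS; the sum is direct when X is nowhere tangent to S. *)
Definition generator_plus_tangent (p : S) : {vspace 'rV[R]_m} :=
  (<[generator Phi (iota p)]> + submanifold_tangent iota p)%VS.

Definition invariant_splitting (ES : S -> {vspace 'rV[R]_m})
    (E F : M -> {vspace 'rV[R]_m}) : Prop :=
  [/\ (exists k, continuous_subbundle flowout k E) /\
        (exists k, continuous_subbundle flowout k F),
      invariant_subbundle E /\ invariant_subbundle F,
      forall p, E (iota p) = ES p,
      forall p, F (iota p) = generator_plus_tangent p &
      forall x, range flowout x ->
        directv (E x + F x) /\ (E x + F x)%VS = fullv].

End Flowout.
End Manifolds.

(* Main.v *)
Require Import Defs.
From HB Require Import structures.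
From mathcomp Require Import all_boot all_order all_algebra.
From mathcomp Require Import all_classical all_reals all_analysis.
From mathcomp Require Import lra ring.
Set Implicit Arguments.
Unset Strict Implicit.
Unset Printing Implicit Defensive.
Import Order.TTheory GRing.Theory Num.Theory.
Import numFieldNormedType.Exports.
Local Open Scope classical_set_scope.
Local Open Scope ring_scope.

(** Invariance leaves no choice: over the point Phi^t(p), with p in S, the fibres
    of E and F have to be the images of E_p and of F_p = span X_p + T_pS under
    dPhi^t. This gives uniqueness ([flow_extension_unique]), and existence
    reduces to two questions.

    _Well-definedness._ An orbit may return to S, say Phi^r(p) = q with p and q in
    S, and then dPhi^r has to carry E_p to E_q and F_p to F_q. This is where the
    Lyapunov exponents enter. By (a) there is a rate c strictly between the
    forward exponents of E_p and those of F_p, and E_p consists exactly of the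
    vectors whose norm is O(e^(ct)) in the future: such a vector is e + f with e
    in E_p and f in F_p, so f also is O(e^(ct)), which forces f = 0
    ([splitting_growth]). The subspaces of T_qM of vectors of growth O(e^(ct))
    form a chain when c varies, and dPhi^r preserves growth rates. Hence
    dPhi^r(E_p) and E_q are comparable for inclusion, and they have the same
    dimension ([growth_transport]). Hypothesis (b) characterizes F_p in the same
    way by growth in the past.

    _Continuity._ The image N of the flowout j : R x S -> M carries the coinduced
    topology, so a local frame of E has to be defined on the points of N, and
    not on the parameters (t, p), of which a point of N may have many. Pushing
    local frames along S forward by the flow only yields continuous frames of
    the pull-back of E to R x S ([continuous_transport]). In a chart around a
    point x of N, let Q be a matrix whose kernel is a complement of E_x. Near x
    the fibre E_y remains complementary to the kernel of Q, so that E_y has one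
    basis that Q sends to the standard basis. This basis depends on y only,
    and it is obtained from any pulled-back frame by inverting a matrix, so it
    is continuous ([coinduced_subbundle]).

    The flowout is an immersion because Phi^s = Phi^t o Phi^(s - t): its differential
    at (t, p) is dPhi^t composed with (c, v) |-> c X_p + v, which is injective
    on R x T_pS as X is not tangent to S ([diff_flowout]). Its smoothness is a
    chain rule for C^k maps ([Ck_on_comp]). *)

(** * Continuity at a point, differentials and C^k maps *)

Lemma open_setI_preimage (X Y : topologicalType) (A : set X) (B : set Y)
    (f : X -> Y) :
  open A -> open B -> (forall x, A x -> {for x, continuous f}) ->
  open (A `&` f @^-1` B).
Proof.
move=> oA oB fc; rewrite openE => x [Ax Bfx]; apply: filterI.
  by apply: open_nbhs_nbhs.
by apply: (fc x Ax); exact: open_nbhs_nbhs.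
Qed.

Lemma continuous_pair (X Y Z : topologicalType) (f : X -> Y) (h : X -> Z) x :
  {for x, continuous f} -> {for x, continuous h} ->
  {for x, continuous (fun y => (f y, h y))}.
Proof. by move=> fc hc; exact: cvg_pair fc hc. Qed.

Lemma continuous_near_eq (X Y : topologicalType) (f h : X -> Y) z :
  (\forall y \near z, f y = h y) -> {for z, continuous f} -> {for z, continuous h}.
Proof.
move=> fh fc; rewrite /prop_for /continuous_at -(nbhs_singleton fh).
by apply: cvg_trans fc; exact: near_eq_cvg.
Qed.

Section Differentials.
Context {R : realType}.
Implicit Types V W Z : normedModType R.

Lemma near_eq_is_diff V W (f h : V -> W) (x : V) :
  (\forall y \near x, f y = h y) -> differentiable f x ->
  differentiable h x /\ 'd h x = 'd f x :> (V -> W).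
Proof.
move=> fh df.
have [dc] := (diff_locallyP x f).1 df => /eqaddoP fE.
(* The first-order expansion of [f] at [x] is also one of [h]. *)
have hE : h \o shift x = cst (h x) + 'd f x +o_ 0 id.
  apply/eqaddoP => e e0; have := fE e e0.
  have fhx : f x = h x by exact: nbhs_singleton fh.
  have : \forall y \near (0 : V), f (y + x) = h (y + x).
    by move: fh; rewrite (near_shift 0 x) subr0.
  apply: filterS2 => y fhy; rewrite /= !fctE /= /cst -fhy -fhx; exact.
have E : 'd h x = 'd f x :> (V -> W) by apply: diff_unique.
split; last exact: E.
by apply/diff_locallyP; rewrite E; split; [exact: dc|exact: hE].
Qed.

Lemma near_eq_diffable V W (f h : V -> W) (x : V) :
  (\forall y \near x, f y = h y) -> differentiable f x -> differentiable h x.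
Proof. by move=> fh /(near_eq_is_diff fh)[]. Qed.

Lemma near_eq_diff V W (f h : V -> W) (x v : V) :
  (\forall y \near x, f y = h y) -> differentiable f x -> 'd h x v = 'd f x v.
Proof. by move=> fh /(near_eq_is_diff fh)[_ ->]. Qed.

Lemma diff_compE V W Z (f : V -> W) (h : W -> Z) (x v : V) :
  differentiable f x -> differentiable h (f x) ->
  'd (h \o f) x v = 'd h (f x) ('d f x v).
Proof. by move=> df dh; rewrite (diff_comp df dh). Qed.

Lemma linear_is_diff V W (f : V -> W) (x : V) : linear f -> continuous f ->
  differentiable f x /\ 'd f x = f :> (V -> W).
Proof.
move=> fl fc.
pose g := GRing.isLinear.Build R V W _ f fl.
pose F : {linear V -> W} := HB.pack f g.
have Fc : continuous F by [].
split; first exact: (@linear_differentiable _ _ _ F).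
exact: (@diff_lin _ _ _ F).
Qed.

Lemma diff_slicel V W (x : V) (y : W) :
  differentiable (fun s : V => (s, y)) x /\
  forall v, 'd (fun s : V => (s, y)) x v = (v, 0).
Proof.
have d1 : differentiable (fun s : V => s) x by [].
have d2 := differentiable_cst y x.
split; first exact: differentiable_pair d1 d2.
move=> v; have := congr1 (@^~ v) (diff_pair d1 d2) => /= ->.
by rewrite diff_cst diff_val.
Qed.

Lemma diff_slicer V W (x : V) (y : W) :
  differentiable (fun s : W => (x, s)) y /\
  forall v, 'd (fun s : W => (x, s)) y v = (0, v).
Proof.
have d1 : differentiable (fun s : W => s) y by [].
have d2 := differentiable_cst x y.
split; first exact: differentiable_pair d2 d1.
move=> v; have := congr1 (@^~ v) (diff_pair d2 d1) => /= ->.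
by rewrite diff_cst diff_val.
Qed.

Lemma diff_shift V (a x : V) :
  differentiable (fun s : V => s - a) x /\
  forall v, 'd (fun s : V => s - a) x v = v.
Proof.
have d1 : differentiable (fun s : V => s) x by [].
have d2 := differentiable_cst a x.
split; first exact: differentiableB d1 d2.
move=> v; have := congr1 (@^~ v) (diffB d1 d2) => /= ->.
by rewrite diff_cst diff_val /= subr0.
Qed.

End Differentials.

Section Smooth.
Context {R : realType}.
Implicit Types V W Z : normedModType R.

Lemma Ck_on_sub V W k (U U' : set V) (f : V -> W) :
  U `<=` U' -> Ck_on k U' f -> Ck_on k U f.
Proof.
move=> UU'; elim: k f => [|k IH] f /=; first by move=> fc x /UU'/fc.
by case=> fd fk; split=> [x /UU'/fd//|v]; exact/IH/fk.
Qed.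

Lemma Ck_on_eq V W k (U : set V) (f h : V -> W) : open U ->
  (forall x, U x -> f x = h x) -> Ck_on k U f -> Ck_on k U h.
Proof.
move=> oU; elim: k f h => [|k IH] f h fh /=.
  move=> fc x Ux; have nx : \forall y \near x, f y = h y.
    by apply: filterS fh _; exact: open_nbhs_nbhs.
  exact: continuous_near_eq nx (fc x Ux).
have nx x : U x -> \forall y \near x, f y = h y.
  by move=> Ux; apply: filterS fh _; exact: open_nbhs_nbhs.
case=> fd fk; split=> [x Ux|v].
  by have [] := near_eq_is_diff (nx x Ux) (fd x Ux).
apply: IH (fk v) => x Ux.
by have [_ ->] := near_eq_is_diff (nx x Ux) (fd x Ux).
Qed.

Lemma Ck_onW V W k (U : set V) (f : V -> W) : Ck_on k.+1 U f -> Ck_on k U f.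
Proof.
elim: k f => [|k IH] f.
  by case=> fd _ x Ux; exact/differentiable_continuous/fd.
by case=> fd fk; split=> // v; exact/IH/fk.
Qed.

Lemma Ck_on_cst V W k (U : set V) (w : W) : Ck_on k U (fun _ : V => w).
Proof.
elim: k w => [|k IH] w; first by move=> x _; exact: cst_continuous.
split=> [x _|v]; first exact: differentiable_cst.
have -> : (fun x : V => 'd (fun _ : V => w) x v) = fun _ => 0.
  by apply/funext => x; rewrite diff_cst.
exact: IH.
Qed.

Lemma Ck_on_linear V W k (U : set V) (f : V -> W) :
  linear f -> continuous f -> Ck_on k U f.
Proof.
case: k => [|k] fl fc; first by move=> x _; exact: fc.
split=> [x _|v]; first by have [] := linear_is_diff x fl fc.
have -> : (fun x : V => 'd f x v) = fun _ => f v.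
  by apply/funext => x; have [_ ->] := linear_is_diff x fl fc.
exact: Ck_on_cst.
Qed.

Lemma Ck_onD V W k (U : set V) (f h : V -> W) : open U ->
  Ck_on k U f -> Ck_on k U h -> Ck_on k U (fun x => f x + h x).
Proof.
move=> oU; elim: k f h => [|k IH] f h.
  by move=> fc hc x Ux; apply: cvgD; [exact: fc|exact: hc].
case=> fd fk [hd hk]; split=> [x Ux|v].
  by apply: differentiableD; [exact: fd|exact: hd].
apply: (Ck_on_eq oU _ (IH _ _ (fk v) (hk v))) => x Ux.
by rewrite -[fun x => _ + _]/(f + h) diffD; [|exact: fd|exact: hd].
Qed.

Lemma Ck_on_sum V W k (U : set V) (I : finType) (f : I -> V -> W) : open U ->
  (forall i, Ck_on k U (f i)) -> Ck_on k U (fun x => \sum_i f i x).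
Proof.
move=> oU fk; elim: (index_enum I) => [|i s IH].
  by under eq_fun do rewrite big_nil; exact: Ck_on_cst.
by under eq_fun do rewrite big_cons; exact: Ck_onD.
Qed.

Lemma diff_scale V W (c : V -> R^o) (f : V -> W) (x : V) :
  differentiable c x -> differentiable f x ->
  differentiable (fun y => c y *: f y) x /\
  forall v, 'd (fun y => c y *: f y) x v = c x *: 'd f x v + 'd c x v *: f x.
Proof.
move=> dc df.
have blin : bilinear_for
    (GRing.Scale.Law.clone _ _ *:%R _) (GRing.Scale.Law.clone _ _ *:%R _)
    (fun (a : R^o) (w : W) => a *: w).
  split=> [u'|u] a y z /=; first by rewrite scalerDl scalerA.
  by rewrite scalerDr !scalerA mulrC.
pose bM := bilinear_isBilinear.Build R R^o W W _ _
  (fun (a : R^o) (w : W) => a *: w) blin.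
pose B : {bilinear R^o -> W -> W} := HB.pack (fun (a : R^o) (w : W) => a *: w) bM.
have Bc : continuous (fun p : R^o * W => B p.1 p.2).
  by move=> p; exact: scale_continuous.
have dp := differentiable_pair dc df.
have dB := differentiable_bilin (c x, f x) Bc.
split; first exact: (differentiable_comp dp dB).
move=> v; have E1 := congr1 (@^~ v) (diff_comp dp dB).
have E2 := congr1 (@^~ ('d (fun y => (c y, f y)) x v)) (diff_bilin (c x, f x) Bc).
have E3 := congr1 (@^~ v) (diff_pair dc df).
rewrite /= in E1 E2 E3; rewrite [LHS]E1 [LHS]E2 E3 //=.
Qed.

Lemma Ck_onZ V W k (U : set V) (c : V -> R^o) (f : V -> W) : open U ->
  Ck_on k U c -> Ck_on k U f -> Ck_on k U (fun x => c x *: f x).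
Proof.
move=> oU; elim: k c f => [|k IH] c f.
  by move=> cc fc x Ux; apply: cvgZ; [exact: cc|exact: fc].
move=> ck1 fk1; have ck' := Ck_onW ck1; have fk' := Ck_onW fk1.
case: ck1 fk1 => cd ck [fd fk]; split=> [x Ux|v].
  by have [] := diff_scale (cd x Ux) (fd x Ux).
apply: (Ck_on_eq oU _ (Ck_onD oU (IH _ _ ck' (fk v)) (IH _ _ (ck v) fk'))).
by move=> x Ux; have [_ ->] := diff_scale (cd x Ux) (fd x Ux).
Qed.

Lemma Ck_on_comp_linear V W Z k (U : set V) (L : W -> Z) (f : V -> W) :
  open U -> linear L -> continuous L -> Ck_on k U f -> Ck_on k U (L \o f).
Proof.
move=> oU Ll Lc; elim: k f => [|k IH] f.
  by move=> fc x Ux; apply: continuous_comp; [exact: fc|exact: Lc].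
case=> fd fk; have Ld y := linear_is_diff y Ll Lc.
split=> [x Ux|v].
  by apply: differentiable_comp; [exact: fd|exact: (Ld _).1].
apply: (Ck_on_eq oU _ (IH _ (fk v))) => x Ux.
rewrite diff_comp; [|exact: fd|exact: (Ld _).1].
by rewrite /= (Ld _).2.
Qed.

Lemma Ck_on_pair V W Z k (U : set V) (f : V -> W) (h : V -> Z) : open U ->
  Ck_on k U f -> Ck_on k U h -> Ck_on k U (fun x => (f x, h x) : (W * Z)%type).
Proof.
move=> oU; elim: k f h => [|k IH] f h.
  by move=> fc hc x Ux; apply: cvg_pair; [exact: fc|exact: hc].
case=> fd fk [hd hk]; split=> [x Ux|v].
  by apply: differentiable_pair; [exact: fd|exact: hd].
apply: (Ck_on_eq oU _ (IH _ _ (fk v) (hk v))) => x Ux.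
by rewrite diff_pair; [|exact: fd|exact: hd].
Qed.

(** Finite dimension, in the form in which differentials are expanded along
    fixed directions. *)
Definition finite_coords W (I : finType) (e : I -> W) (pi : I -> W -> R^o) :=
  (forall i, linear (pi i) /\ continuous (pi i)) /\
  (forall w, w = \sum_i pi i w *: e i).

(** The regularity of the differential of [h] is only known in fixed directions,
    whereas the chain rule evaluates it in the moving direction ['d f x v]. The
    coordinates of the space in between turn the composite differential into a
    finite sum of scalars times partial derivatives of [h], to which the
    induction hypothesis and the product rule apply. *)
Lemma Ck_on_comp V W Z (I : finType) (e : I -> W) (pi : I -> W -> R^o) k
    (U : set V) (U' : set W) (f : V -> W) (h : W -> Z) :
  finite_coords e pi -> open U -> open U' -> (forall x, U x -> U' (f x)) ->
  Ck_on k U f -> Ck_on k U' h -> Ck_on k U (h \o f).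
Proof.
move=> [pil piE] oU oU' fU; elim: k f h fU => [|k IH] f h fU.
  by move=> fc hc x Ux; apply: continuous_comp; [exact: fc|exact/hc/fU].
move=> fk1; have fk' := Ck_onW fk1; case: fk1 => fd fk [hd hk].
split=> [x Ux|v].
  by apply: differentiable_comp; [exact: fd|exact/hd/fU].
have K : Ck_on k U (fun x => \sum_i pi i ('d f x v) *: 'd h (f x) (e i)).
  apply: Ck_on_sum => // i; apply: Ck_onZ => //.
    by apply: (Ck_on_comp_linear oU _ _ (fk v)); have [] := pil i.
  exact: (IH f (fun y => 'd h y (e i)) fU fk' (hk _)).
apply: (Ck_on_eq oU _ K) => x Ux.
rewrite (diff_comp (fd _ Ux) (hd _ (fU _ Ux))).
rewrite /= [in RHS](piE ('d f x v)) raddf_sum /=.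
by apply: eq_bigr => i _; rewrite linearZ.
Qed.

Lemma Ck_on_locally V W k (U : set V) (f : V -> W) :
  (forall x, U x -> exists2 U' : set V, U' x & Ck_on k U' f) -> Ck_on k U f.
Proof.
elim: k f => [|k IH] f H; first by move=> x /H[U' U'x]; exact.
split=> [x Ux|v].
  by have [U' U'x [fd _]] := H x Ux; exact: fd.
by apply: IH => x Ux; have [U' U'x [_ fk]] := H x Ux; exists U'; last exact: fk.
Qed.

Lemma finite_coords_rV n : finite_coords (fun i : 'I_n => delta_mx 0 i : 'rV[R]_n)
   (fun i (w : 'rV[R]_n) => w 0 i : R^o).
Proof.
split=> [i|w]; last by rewrite {1}(row_sum_delta w).
split; first by move=> a u v; rewrite !mxE.
exact: coord_continuous.
Qed.

Lemma finite_coords_prod_rV n :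
  finite_coords
    (fun i : unit + 'I_n =>
       (if i is inr j then (0, delta_mx 0 j) else (1, 0)) : (R^o * 'rV[R]_n)%type)
    (fun i w => (if i is inr j then w.2 0 j else w.1) : R^o).
Proof.
split=> [[i|i]|[w1 w2]].
- by split=> // z; exact: cvg_fst.
- split; first by move=> a u v; rewrite !mxE.
  move=> z; apply: (@continuous_comp _ _ _ snd (fun w : 'rV[R]_n => w 0 i : R^o)).
    exact: cvg_snd.
  exact: coord_continuous.
rewrite big_sumType /= (big_pred1 tt); last by case.
have -> : \sum_(i < n) w2 0 i *: ((0, delta_mx 0 i) : (R^o * 'rV[R]_n)%type) = (0, w2).
  rewrite [in RHS](row_sum_delta w2).
  elim/big_rec2: _ => // i y1 y2 _ ->.
  by congr pair; rewrite /= ?scaler0 ?addr0.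
by congr pair; rewrite /= ?addr0 ?scaler0 ?add0r //; exact/esym/mulr1.
Qed.

End Smooth.

(** * Differentials of maps into and between manifolds *)

Local Opaque diff.

Section MapsInto.
Context {R : realType} {n : nat} {M : smooth_manifold R n}.
Implicit Types (V W : normedModType R) (b c : chart R M n) (p : M).

(** Continuity is what keeps the values near [x] inside a chart around [f x], so
    that [f] can be read in that chart. *)
Definition diffable_into V (f : V -> M) (x : V) : Prop :=
  {for x, continuous f} /\
  forall c, atlas M c -> cdom c (f x) -> differentiable (cmap c \o f) x.

Lemma smooth_into_diffable V (U : set V) (f : V -> M) x :
  smooth_into U f -> U x -> diffable_into f x.
Proof.
move=> [fc fs] Ux; split; first exact: fc.
by move=> c cA cfx; have [fd _] := fs c cA 1%N; exact: fd.
Qed.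

Lemma near_cdom (Y : topologicalType) (f : Y -> M) x c :
  {for x, continuous f} -> cdom c (f x) -> \forall y \near x, cdom c (f y).
Proof.
move=> fc cfx; apply: fc; apply: open_nbhs_nbhs; split=> //; exact: cdom_open.
Qed.

Lemma diff_cmap_cinv c x v : ccod c x -> 'd (cmap c \o cinv c) x v = v.
Proof.
move=> cx; have nx : \forall y \near x, id y = (cmap c \o cinv c) y.
  have : \forall y \near x, ccod c y.
    by apply: open_nbhs_nbhs; split=> //; exact: ccod_open.
  by apply: filterS => y cy; rewrite /= cinvK.
have [did idE] := linear_is_diff (f := id) x (fun a u v => erefl) (fun x => cvg_id).
by apply: etrans (near_eq_diff v nx did) _; rewrite idE.
Qed.

Lemma diffable_into_cinv c x : atlas M c -> ccod c x -> diffable_into (cinv c) x.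
Proof.
move=> cA cx; split; first exact: cinv_continuous.
move=> b bA bx; have [fd _] := atlas_compatible cA bA 1%N; exact: fd.
Qed.

(** Near [x], reading [f] in the chart [c] amounts to reading it in the chart [b]
    and then applying the transition map. *)
Lemma diff_chart_change V (f : V -> M) x b c v : diffable_into f x ->
  atlas M b -> atlas M c -> cdom b (f x) -> cdom c (f x) ->
  'd (cmap c \o f) x v =
  'd (cmap c \o cinv b) (cmap b (f x)) ('d (cmap b \o f) x v).
Proof.
move=> [fc fd] bA cA bfx cfx.
have dt : differentiable (cmap c \o cinv b) ((cmap b \o f) x).
  apply: (diffable_into_cinv bA (cmap_cod bfx)).2 => //=.
  by rewrite cmapK.
have db := fd b bA bfx.
have nx : \forall y \near x,
    ((cmap c \o cinv b) \o (cmap b \o f)) y = (cmap c \o f) y.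
  by apply: filterS (near_cdom fc bfx) => y by_; rewrite /= cmapK.
apply: etrans (near_eq_diff v nx (differentiable_comp db dt)) _.
exact: diff_compE db dt.
Qed.

Lemma transition_diffK b c p : atlas M b -> atlas M c -> cdom b p -> cdom c p ->
  cancel ('d (cmap c \o cinv b) (cmap b p)) ('d (cmap b \o cinv c) (cmap c p)).
Proof.
move=> bA cA bp cp v.
have bx := cmap_cod bp.
have bpK : cinv b (cmap b p) = p := cmapK bp.
have cd := diffable_into_cinv bA bx.
have := @diff_chart_change _ (cinv b) (cmap b p) c b v cd cA bA.
by rewrite bpK => /(_ cp bp) <-; exact: diff_cmap_cinv.
Qed.

(** A differential takes values in the preferred chart at the image point, and
    preferred charts may jump from one point to the next. All statements about
    the dependence on the point are therefore made after [tangent_coord], in one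
    fixed chart. *)
Lemma tangent_coord_diff_into V (f : V -> M) x c v : diffable_into f x ->
  atlas M c -> cdom c (f x) ->
  tangent_coord (M := M) c (f x) (diff_into f x v) = 'd (cmap c \o f) x v.
Proof.
move=> fd cA cfx; rewrite /tangent_coord /diff_into.
rewrite -(diff_chart_change v fd) //; first exact: chart_at_atlas.
exact: mem_chart_at.
Qed.

Lemma diff_into_cinvK c p v : atlas M c -> cdom c p ->
  diff_into (M := M) (cinv c) (cmap c p) (tangent_coord (M := M) c p v) = v.
Proof.
move=> cA cp; rewrite /diff_into /tangent_coord cmapK //.
by rewrite transition_diffK //; [exact: chart_at_atlas|exact: mem_chart_at].
Qed.

Lemma tangent_coord_inj c p : atlas M c -> cdom c p ->
  injective (tangent_coord (M := M) c p).
Proof. by move=> cA cp; apply: can_inj => v; exact: diff_into_cinvK. Qed.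

Lemma tangent_coordK c p v : atlas M c -> cdom c p ->
  tangent_coord (M := M) c p (diff_into (M := M) (cinv c) (cmap c p) v) = v.
Proof.
move=> cA cp; have cx := cmap_cod cp; have pK : cinv c (cmap c p) = p := cmapK cp.
have E := tangent_coord_diff_into (c := c) v (diffable_into_cinv cA cx) cA.
by rewrite pK in E; apply: etrans (E cp) _; exact: diff_cmap_cinv.
Qed.

Lemma tangent_coord_sum b p (I : finType) (c : I -> R) (u : I -> 'rV[R]_n) :
  tangent_coord (M := M) b p (\sum_i c i *: u i) =
  \sum_i c i *: tangent_coord (M := M) b p (u i).
Proof.
by rewrite /tangent_coord linear_sum; apply: eq_bigr => i _; rewrite linearZ.
Qed.

Lemma tangent_coordB b p (u v : 'rV[R]_n) :
  tangent_coord (M := M) b p (u - v) =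
  tangent_coord (M := M) b p u - tangent_coord (M := M) b p v.
Proof. by rewrite /tangent_coord linearB. Qed.

Lemma near_eq_diff_into V (f h : V -> M) x : (\forall y \near x, f y = h y) ->
  diffable_into f x ->
  diffable_into h x /\ forall v, diff_into h x v = diff_into f x v.
Proof.
move=> fh [fc fd]; have fhx : f x = h x := nbhs_singleton fh.
have nc (c : chart R M n) : \forall y \near x, (cmap c \o f) y = (cmap c \o h) y.
  by apply: filterS fh => y /= ->.
split; first split.
- exact: continuous_near_eq fh fc.
- by move=> c cA chx; have [] := near_eq_is_diff (nc c) (fd c cA _); rewrite ?fhx.
move=> v; rewrite /diff_into -fhx.
apply: near_eq_diff (nc (chart_at (f x))) (fd _ (chart_at_atlas _) _).
exact: mem_chart_at.
Qed.

Lemma diff_into_precomp V W (h : V -> W) (f : W -> M) x :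
  differentiable h x -> diffable_into f (h x) ->
  diffable_into (f \o h) x /\
  forall v, diff_into (f \o h) x v = diff_into f (h x) ('d h x v).
Proof.
move=> hd [fc fd]; split; first split.
- by apply: continuous_comp => //; exact: differentiable_continuous.
- by move=> c cA cf; apply: (differentiable_comp hd (fd c cA cf)).
move=> v; rewrite /diff_into.
have cA := chart_at_atlas (f (h x)); have cf := mem_chart_at (f (h x)).
exact: (diff_compE v hd (fd _ cA cf)).
Qed.

End MapsInto.

Section MapsBetween.
Context {R : realType} {n1 n2 : nat}.
Context {M1 : smooth_manifold R n1} {M2 : smooth_manifold R n2}.
Implicit Types (f : M1 -> M2) (p : M1).

(** It is enough to read [f] in the preferred chart at [p], because [mdiff] does
    not refer to any other one. *)
Definition mdiffable f p : Prop :=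
  diffable_into (f \o cinv (chart_at p)) (cmap (chart_at p) p).

Lemma mdiffable_continuous f p : mdiffable f p -> {for p, continuous f}.
Proof.
move=> [fc _]; have cp := mem_chart_at p.
have nx : \forall y \near p,
    ((f \o cinv (chart_at p)) \o cmap (chart_at p)) y = f y.
  by apply: filterS (near_cdom cvg_id cp) => y cy; rewrite /= cmapK.
apply: continuous_near_eq nx _.
by apply: continuous_comp => //; exact: cmap_continuous.
Qed.

(** Chain rule. The chart at [h x] that the definition of [mdiff] inserts between
    [h] and [f] cancels out near [x]. *)
Lemma diff_into_comp (V : normedModType R) (h : V -> M1) f (x : V) :
  diffable_into h x -> mdiffable f (h x) ->
  diffable_into (f \o h) x /\
  forall v, diff_into (f \o h) x v = mdiff f (h x) (diff_into h x v).
Proof.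
move=> hd fd; have [hc hd'] := hd; set a := chart_at (h x).
have aA : atlas M1 a := chart_at_atlas _.
have ap : cdom a (h x) := mem_chart_at _.
have pK : cinv a (cmap a (h x)) = h x := cmapK ap.
have nx (c : chart R M2 n2) : \forall y \near x,
    ((cmap c \o (f \o cinv a)) \o (cmap a \o h)) y = (cmap c \o (f \o h)) y.
  by apply: filterS (near_cdom hc ap) => y ay; rewrite /= cmapK.
have da := hd' a aA ap.
have dc c : atlas M2 c -> cdom c (f (h x)) ->
    differentiable (cmap c \o (f \o cinv a)) ((cmap a \o h) x).
  by move=> cA cf; apply: fd.2 => //; rewrite /= pK.
split; first split.
- by apply: continuous_comp => //; exact: mdiffable_continuous.
- move=> c cA cf.
  exact: (near_eq_diffable (nx c) (differentiable_comp da (dc c cA cf))).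
move=> v; rewrite /mdiff /diff_into /= -/a pK.
have cA := chart_at_atlas (f (h x)); have cf := mem_chart_at (f (h x)).
apply: etrans (near_eq_diff v (nx _) (differentiable_comp da (dc _ cA cf))) _.
exact: diff_compE da (dc _ cA cf).
Qed.

Lemma near_eq_mdiff f h p : (\forall q \near p, f q = h q) -> mdiffable f p ->
  mdiffable h p /\ forall v, mdiff h p v = mdiff f p v.
Proof.
move=> fh fd; have cp := mem_chart_at p.
apply: (@near_eq_diff_into _ _ _ _ _ (h \o cinv (chart_at p)) _ _ fd).
have cc := cinv_continuous (cmap_cod cp).
by rewrite /prop_for /continuous_at cmapK // in cc; exact: cc _ fh.
Qed.

Lemma tangent_coord_mdiff f p a b v : mdiffable f p ->
  atlas M1 a -> atlas M2 b -> cdom a p -> cdom b (f p) ->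
  tangent_coord (M := M2) b (f p) (mdiff f p v) =
  'd (cmap b \o (f \o cinv a)) (cmap a p) (tangent_coord (M := M1) a p v).
Proof.
move=> fd aA bA ap bf; have pK : cinv a (cmap a p) = p := cmapK ap.
have cd := diffable_into_cinv aA (cmap_cod ap).
have fd' : mdiffable f (cinv a (cmap a p)) by rewrite pK.
have [fcd E] := diff_into_comp cd fd'.
have K : diff_into (f \o cinv a) (cmap a p) (tangent_coord (M := M1) a p v) =
    mdiff f p v.
  apply: etrans (E _) _.
  have vK := diff_into_cinvK v aA ap.
  move: vK; set u := diff_into (cinv a) _ _ => ->.
  exact: (congr1 (fun q => mdiff f q v) pK).
have L := tangent_coord_diff_into (c := b) (tangent_coord (M := M1) a p v) fcd bA.
rewrite /= pK in L; exact: etrans (congr1 _ (esym K)) (L bf).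
Qed.

Lemma mdiff_sum f p (I : finType) (c : I -> R) (u : I -> 'rV[R]_n1) :
  mdiff f p (\sum_i c i *: u i) = \sum_i c i *: mdiff f p (u i).
Proof. by rewrite linear_sum; apply: eq_bigr => i _; rewrite linearZ. Qed.

Lemma smooth_map_mdiffable f p : smooth_map f -> mdiffable f p.
Proof.
move=> fs; apply: (smooth_into_diffable (fs _ (chart_at_atlas p))).
exact/cmap_cod/mem_chart_at.
Qed.

End MapsBetween.

Lemma mdiff_comp (R : realType) n1 n2 n3 (M1 : smooth_manifold R n1)
    (M2 : smooth_manifold R n2) (M3 : smooth_manifold R n3)
    (h : M1 -> M2) (f : M2 -> M3) p :
  mdiffable h p -> mdiffable f (h p) ->
  mdiffable (f \o h) p /\
  forall v, mdiff (f \o h) p v = mdiff f (h p) (mdiff h p v).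
Proof.
move=> hd fd; set a := chart_at p.
have pK : cinv a (cmap a p) = p := cmapK (mem_chart_at p).
have fd' : mdiffable f ((h \o cinv a) (cmap a p)) by rewrite /= pK.
have [fhd E] := diff_into_comp hd fd'.
split; [exact: fhd|move=> v].
have E1 : mdiff (f \o h) p v = mdiff f (h (cinv a (cmap a p))) (mdiff h p v).
  exact: E v.
apply: etrans E1 _.
exact: (congr1 (fun q => mdiff f (h q) (mdiff h p v)) pK).
Qed.

Lemma mdiff_id (R : realType) n (M : smooth_manifold R n) (p : M) :
  mdiffable (@id M) p /\ forall v, mdiff (@id M) p v = v.
Proof.
have cA := chart_at_atlas p; have cp := mem_chart_at p.
have pK : cinv (chart_at p) (cmap (chart_at p) p) = p := cmapK cp.
split=> [|v]; first exact: (diffable_into_cinv cA (cmap_cod cp)).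
by rewrite /mdiff /diff_into /= pK; exact: diff_cmap_cinv (cmap_cod cp).
Qed.

(** * Flows and the flowout of a submanifold *)

Section Flow.
Context {R : realType} {m : nat} {M : smooth_manifold R m} (Phi : smooth_flow M).

Definition flow_chart (a : chart R M m) (z : R^o * 'rV[R]_m) : M :=
  Phi z.1 (cinv a z.2).

Definition flow_chart_dom (a : chart R M m) : set (R^o * 'rV[R]_m) :=
  [set z | ccod a z.2 /\ flow_dom Phi (cinv a z.2) z.1].

Lemma open_flow_chart_dom a : open (flow_chart_dom a).
Proof.
pose D := [set z : R^o * 'rV[R]_m | ccod a z.2].
have oD : open D.
  rewrite (_ : D = setT `&` snd @^-1` ccod a); last by rewrite setTI.
  apply: open_setI_preimage; [exact: openT|exact: ccod_open|].
  by move=> z _; exact: cvg_snd.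
pose f (z : R^o * 'rV[R]_m) : R * M := (z.1, cinv a z.2).
suff fc z : D z -> {for z, continuous f}.
  exact: (open_setI_preimage oD (@flow_dom_open _ _ _ Phi) fc).
move=> Dz; apply: continuous_pair; first exact: cvg_fst.
apply: (@continuous_comp _ _ _ snd (cinv a)); first exact: cvg_snd.
exact: cinv_continuous.
Qed.

Lemma diffable_flow_chart a z : atlas M a -> flow_chart_dom a z ->
  diffable_into (flow_chart a) z.
Proof. by move=> aA; exact: smooth_into_diffable (@flow_smooth _ _ _ Phi _ aA). Qed.

Lemma mdiffable_flow t p : flow_dom Phi p t -> mdiffable (Phi t) p.
Proof.
move=> pt; have aA := chart_at_atlas p; have ap := mem_chart_at p.
have [d _] := diff_slicer (t : R^o) (cmap (chart_at p) p).
have fd : diffable_into (flow_chart (chart_at p)) (t : R^o, cmap (chart_at p) p).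
  by apply: diffable_flow_chart => //; split; [exact: cmap_cod|rewrite /= cmapK].
by have [] := diff_into_precomp d fd.
Qed.

Lemma near_flow_dom t p : flow_dom Phi p t -> \forall q \near p, flow_dom Phi q t.
Proof.
move=> pt; have c : {for p, continuous (fun q : M => (t, q))}.
  by apply: continuous_pair; [exact: cvg_cst|exact: cvg_id].
apply: (c [set z : R * M | flow_dom Phi z.2 z.1]).
by apply: open_nbhs_nbhs; split=> //; exact: (@flow_dom_open _ _ _ Phi).
Qed.

Lemma mdiff_flowD s t p v : flow_dom Phi p s -> flow_dom Phi (Phi s p) t ->
  mdiff (Phi (t + s)) p v = mdiff (Phi t) (Phi s p) (mdiff (Phi s) p v).
Proof.
move=> ps pst; have ds := mdiffable_flow ps.
have [dc E] := mdiff_comp ds (mdiffable_flow pst).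
apply: etrans (E v).
have [|_] := near_eq_mdiff (h := Phi (t + s)) _ dc; last exact.
have n1 := near_flow_dom ps.
have n2 := mdiffable_continuous ds (near_flow_dom pst).
by apply: filterS2 n1 n2 => q qs qt /=; rewrite flowD.
Qed.

Lemma mdiff_flow0 p v : mdiff (Phi 0) p v = v.
Proof.
have [di E] := mdiff_id p; apply: etrans (E v).
have [|_] := near_eq_mdiff (h := Phi 0) _ di; last exact.
by apply: nearW => q; rewrite flow0.
Qed.

Definition complete_at p := flow_dom Phi p = setT.

Lemma complete_flow s p : complete_at p -> complete_at (Phi s p).
Proof.
move=> pT; apply/seteqP; split=> // t _.
by apply/(@flow_domD _ _ _ Phi p s t); rewrite pT.
Qed.

Lemma flowDc s t p : complete_at p -> Phi t (Phi s p) = Phi (t + s) p.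
Proof. by move=> pT; rewrite flowD // ?pT ?complete_flow. Qed.

Lemma mdiff_flowDc s t p v : complete_at p ->
  mdiff (Phi (t + s)) p v = mdiff (Phi t) (Phi s p) (mdiff (Phi s) p v).
Proof. by move=> pT; apply: mdiff_flowD; rewrite ?pT ?complete_flow. Qed.

Lemma mdiff_flow_inj t p : complete_at p -> injective (mdiff (Phi t) p).
Proof.
move=> pT; apply: (can_inj (g := mdiff (Phi (- t)) (Phi t p))) => v.
apply: etrans (esym (mdiff_flowDc _ _ _ pT)) _.
by rewrite addNr; exact: mdiff_flow0.
Qed.

End Flow.

Section Flowout.
Context {R : realType} {m d : nat}.
Context {M : smooth_manifold R m} {S : smooth_manifold R d}.
Context (Phi : smooth_flow M) (iota : S -> M).
Hypothesis iotas : smooth_map iota.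
Hypothesis Sc : forall p, complete_at Phi (iota p).

Definition flowout_chart (a : chart R S d) (z : R^o * 'rV[R]_d) : M :=
  flowout Phi iota (z.1, cinv a z.2).

(** Near each point, the flowout is the flow read in a chart of [M] around
    the starting point, preceded by [iota] read in charts. *)
Lemma smooth_flowout_chart a : atlas S a ->
  smooth_into [set z : R^o * 'rV[R]_d | ccod a z.2] (flowout_chart a).
Proof.
move=> aA; have [ic isS] := iotas aA.
pose D := [set z : R^o * 'rV[R]_d | ccod a z.2].
pose N (b : chart R M m) := ccod a `&` (iota \o cinv a) @^-1` cdom b.
have oN (b : chart R M m) : open (N b).
  by apply: open_setI_preimage; [exact: ccod_open|exact: cdom_open|].
pose D' (b : chart R M m) := setT `&` (snd : R^o * 'rV[R]_d -> 'rV[R]_d) @^-1` N b.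
have oD' (b : chart R M m) : open (D' b).
  apply: open_setI_preimage; [exact: openT|exact: oN|].
  by move=> z _; exact: cvg_snd.
pose G (b : chart R M m) (z : R^o * 'rV[R]_d) : R^o * 'rV[R]_m :=
  (z.1, cmap b (iota (cinv a z.2))).
have GE (b : chart R M m) z : D' b z ->
    flow_chart Phi b (G b z) = flowout_chart a z.
  by move=> [_ [z2 z2b]]; rewrite /flow_chart /G /= cmapK.
have Gdom (b : chart R M m) z : D' b z -> flow_chart_dom Phi b (G b z).
  move=> [_ [z2 z2b]]; split=> /=; first exact: cmap_cod.
  by rewrite cmapK // Sc.
have Gk (b : chart R M m) k : atlas M b -> Ck_on k (D' b) (G b).
  move=> bA; apply: Ck_on_pair => //.
    by apply: Ck_on_linear => // z; exact: cvg_fst.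
  apply: (@Ck_on_comp _ _ _ _ _ _ _ k (D' b) (N b) snd
    (cmap b \o (iota \o cinv a)) (finite_coords_rV d)) => //.
  - by move=> z [].
  - by apply: Ck_on_linear => // z; exact: cvg_snd.
  - exact: isS.
have D'z z : D z -> D' (chart_at (iota (cinv a z.2))) z.
  by move=> Dz; split=> //; split=> //=; exact: mem_chart_at.
have fc z : D z -> {for z, continuous (flowout_chart a)}.
  move=> Dz; set b := chart_at (iota (cinv a z.2)).
  have bA : atlas M b := chart_at_atlas _.
  have nz : \forall y \near z, (flow_chart Phi b \o G b) y = flowout_chart a y.
    have : \forall y \near z, D' b y by apply: open_nbhs_nbhs; split=> //; exact: D'z.
    by apply: filterS => y /GE.
  apply: continuous_near_eq nz _.
  apply: continuous_comp; first by exact: (Gk b 0%N bA z (D'z z Dz)).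
  by have [] := diffable_flow_chart bA (Gdom b z (D'z z Dz)).
split=> // c cA k; apply: Ck_on_locally => z [Dz cz].
set b := chart_at (iota (cinv a z.2)).
have bA : atlas M b := chart_at_atlas _.
exists (D' b `&` flowout_chart a @^-1` cdom c); first by split=> //; exact: D'z.
have oU : open (D' b `&` flowout_chart a @^-1` cdom c).
  by apply: open_setI_preimage => //; [exact: cdom_open|move=> y [_ []] ? _; exact: fc].
apply: (@Ck_on_eq _ _ _ _ _ ((cmap c \o flow_chart Phi b) \o G b)) => //.
  by move=> y [D'y _]; rewrite /= GE.
apply: (Ck_on_comp (finite_coords_prod_rV m)
   (U' := flow_chart_dom Phi b `&` flow_chart Phi b @^-1` cdom c)) => //.
- apply: open_setI_preimage; [exact: open_flow_chart_dom|exact: cdom_open|].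
  by move=> y /(diffable_flow_chart bA)[].
- by move=> y [D'y cy]; split; [exact: Gdom|rewrite /= GE].
- by apply: Ck_on_sub (Gk b k bA) => y [].
- exact: (flow_smooth Phi bA).2.
Qed.

(** At time 0 the partial derivatives of the flowout are the generator and
    [mdiff iota]. The group law moves time [t] to time 0: the flowout is [Phi t]
    applied to the flowout translated by [- t] in time. *)
Lemma diff_flowout t p tau (v : 'rV[R]_d) :
  diff_into (flowout_chart (chart_at p)) (t : R^o, cmap (chart_at p) p)
    (tau : R^o, v) =
  mdiff (Phi t) (iota p) (tau *: generator Phi (iota p) + mdiff iota p v).
Proof.
set a := chart_at p; set x := cmap a p.
have aA : atlas S a := chart_at_atlas p; have ap : cdom a p := mem_chart_at p.
have xK : cinv a x = p := cmapK ap.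
have fd s : diffable_into (flowout_chart a) (s : R^o, x).
  apply: smooth_into_diffable (smooth_flowout_chart aA) _; exact: cmap_cod.
have E0 : diff_into (flowout_chart a) (0 : R^o, x) (tau : R^o, v) =
    tau *: generator Phi (iota p) + mdiff iota p v.
  have -> : ((tau : R^o, v) : R^o * 'rV[R]_d) = tau *: (1, 0) + (0, v).
    by congr pair; rewrite /= ?scaler0 ?add0r ?addr0 //; exact/esym/mulr1.
  rewrite linearD linearZ; congr (_ *: _ + _).
    have [d1 d1E] := diff_slicel (0 : R^o) x.
    apply: etrans (congr1 (diff_into _ _) (esym (d1E 1))) _.
    apply: etrans (esym ((diff_into_precomp d1 (fd 0)).2 1)) _.
    have fE : flowout_chart a \o (fun s : R^o => (s, x)) = fun s : R^o => Phi s (iota p).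
      by apply/funext => s; rewrite /flowout_chart /flowout /= xK.
    exact: (congr1 (fun f : R^o -> M => diff_into f 0 1) fE).
  have [d1 d1E] := diff_slicer (0 : R^o) x.
  apply: etrans (congr1 (diff_into _ _) (esym (d1E v))) _.
  apply: etrans (esym ((diff_into_precomp d1 (fd 0)).2 v)) _.
  have fE : flowout_chart a \o (fun s => (0, s)) = iota \o cinv a.
    by apply/funext => s; rewrite /flowout_chart /flowout /= flow0.
  exact: (congr1 (fun f : 'rV[R]_d -> M => diff_into f x v) fE).
have [ds dsE] := diff_shift ((t, 0) : R^o * 'rV[R]_d) (t : R^o, x).
have xs : ((t : R^o, x) : R^o * 'rV[R]_d) - (t, 0) = (0, x).
  by congr pair; rewrite /= ?subrr ?subr0.
have fd0 : diffable_into (flowout_chart a) ((t : R^o, x) - (t, 0)) by rewrite xs.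
have [hd hdE] := diff_into_precomp ds fd0.
have E1 : diff_into (flowout_chart a \o (fun z => z - (t, 0))) (t : R^o, x)
      (tau : R^o, v) =
    tau *: generator Phi (iota p) + mdiff iota p v.
  apply: etrans (hdE _) (etrans _ E0); apply: etrans (congr1 _ (dsE _)) _.
  exact: (congr1 (fun z => diff_into (flowout_chart a) z (tau : R^o, v)) xs).
move: hd E1; set h := _ \o _ => hd E1.
have hx : h (t : R^o, x) = iota p.
  by rewrite /h /= xs /flowout_chart /flowout /= flow0 xK.
have hd' : mdiffable (Phi t) (h (t : R^o, x)).
  by apply: mdiffable_flow; rewrite hx Sc.
have [_ hE] := diff_into_comp hd hd'.
have fE : Phi t \o h = flowout_chart a.
  apply/funext => z; rewrite /h /flowout_chart /flowout /= subr0.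
  by rewrite flowDc ?Sc // addrC subrK.
apply: etrans (congr1 (fun f => diff_into f (t : R^o, x) (tau : R^o, v)) (esym fE)) _.
apply: etrans (hE _) _; apply: etrans (congr1 _ E1) _.
exact: (congr1 (fun q => mdiff (Phi t) q _) hx).
Qed.

End Flowout.

(** * Lyapunov exponents and growth subspaces *)

Local Opaque diff_into mdiff tangent_coord.

Section Limsup.
Context {R : realType}.
Implicit Types (f : R -> \bar R) (a b : \bar R).

Lemma ereal_lt_between a b : (a < b)%E -> exists c : R, (a < c%:E)%E /\ (c%:E < b)%E.
Proof.
case: a b => [a| |] [b| |] //.
- by rewrite lte_fin => ab; exists ((a + b) / 2); rewrite !lte_fin; split; lra.
- by move=> _; exists (a + 1); rewrite lte_fin ltry; split=> //; lra.
- by move=> _; exists (b - 1); rewrite lte_fin ltNyr; split=> //; lra.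
- by move=> _; exists 0; rewrite ltry ltNyr.
Qed.

Lemma ereal_lt_between2 a b : (a < b)%E ->
  exists c c' : R, [/\ (a < c%:E)%E, c < c' & (c'%:E < b)%E].
Proof.
move=> /ereal_lt_between[c [ac /ereal_lt_between[c' [cc' c'b]]]].
by exists c, c'; split.
Qed.

Lemma limf_esup_lt f (F : set_system R) b :
  (limf_esup f F < b)%E -> exists2 A, F A & forall t, A t -> (f t < b)%E.
Proof.
move=> /ereal_inf_lt[_ [A FA <-]] Ab; exists A => // t At.
apply: le_lt_trans Ab; apply: le_ereal_sup_tmp; exists (f t) => //.
Qed.

Lemma limf_esup_le f (F : set_system R) A b :
  F A -> (forall t, A t -> (f t <= b)%E) -> (limf_esup f F <= b)%E.
Proof.
move=> FA Ab; apply: (@le_trans _ _ (ereal_sup (f @` A))).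
  by apply: ge_ereal_inf; exists (ereal_sup (f @` A)) => //; exists A.
by apply/ereal_supP => _ [t At <-]; exact: Ab.
Qed.

End Limsup.

Section Growth.
Context {R : realType} {m : nat} {M : smooth_manifold R m}.
Context (g : riemannian_metric M) (Phi : smooth_flow M).

Lemma metricD p a b u v :
  g p (a *: u + b *: v) (a *: u + b *: v) =
  a ^+ 2 * g p u u + 2 * (a * b) * g p u v + b ^+ 2 * g p v v.
Proof.
have lin w c x y : g p w (c *: x + y) = c * g p w x + g p w y.
  exact: metric_linear.
have linZ w c x : g p w (c *: x) = c * g p w x.
  have := lin w c x 0; rewrite addr0 => ->.
  have := lin w 1 0 0; rewrite scaler0 addr0; lra.
rewrite lin linZ [g p _ u]metric_symmetric [g p _ v]metric_symmetric !lin !linZ.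
rewrite [g p v u]metric_symmetric; ring.
Qed.

Lemma metric0 p : g p 0 0 = 0.
Proof. by have := metricD p 0 0 0 0; rewrite !scale0r addr0 => ->; ring. Qed.

Lemma metric_ge0 p v : 0 <= g p v v.
Proof. by have [->|/metric_pos/ltW//] := eqVneq v 0; rewrite metric0. Qed.

(** A substitute for the triangle inequality: the square of [a *: u - v] is
    nonnegative. *)
Lemma metric_lincomb p a u v :
  g p (a *: u + v) (a *: u + v) <= 2 * a ^+ 2 * g p u u + 2 * g p v v.
Proof.
have := metric_ge0 p (a *: u + (-1) *: v); have := metricD p a 1 u v.
by rewrite scale1r => ->; rewrite metricD; lra.
Qed.

(** Exponential growth of the squared norm at rate [c], towards the future for
    [s = 1] and towards the past for [s = -1]. Unlike a condition on a limit superior,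
    this one is visibly stable under linear combinations and, as [K] and [T]
    are arbitrary, under a change of the starting point on the orbit. *)
Definition growth (s c : R) (p : M) (v : 'rV[R]_m) : Prop :=
  exists K T : R, 0 <= K /\ forall t, T < t ->
    g (Phi (s * t) p) (mdiff (Phi (s * t)) p v) (mdiff (Phi (s * t)) p v)
    <= K * expR (c * t).

Lemma growth_lincomb s c p a u v :
  growth s c p u -> growth s c p v -> growth s c p (a *: u + v).
Proof.
move=> [K [T [K0 uP]]] [K' [T' [K'0 vP]]].
exists (2 * a ^+ 2 * K + 2 * K'), (Num.max T T'); split.
  have a2 := sqr_ge0 a; apply: addr_ge0; last exact: mulr_ge0.
  by rewrite mulr_ge0 // mulr_ge0.
move=> t; rewrite gt_max => /andP[/uP ut /vP vt].
rewrite linearD linearZ; apply: le_trans (metric_lincomb _ _ _ _) _.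
rewrite [leRHS]mulrDl -[_ * K * _]mulrA -[_ * K' * _]mulrA; apply: lerD.
  by apply: ler_wpM2l => //; rewrite mulr_ge0 ?sqr_ge0.
by apply: ler_wpM2l.
Qed.

Lemma growth_le s c c' p v : c <= c' -> growth s c p v -> growth s c' p v.
Proof.
move=> cc' [K [T [K0 vP]]]; exists K, (Num.max T 0); split=> // t.
rewrite gt_max => /andP[/vP vt t0]; apply: le_trans vt _.
by rewrite ler_wpM2l // ler_expR ler_wpM2r // ltW.
Qed.

(** Starting at time [r] shifts the threshold and rescales the constant. *)
Lemma growth_flow s c r p v : s * s = 1 -> complete_at Phi p ->
  growth s c p v -> growth s c (Phi r p) (mdiff (Phi r) p v).
Proof.
move=> ss pT [K [T [K0 vP]]].
exists (K * expR (c * (s * r))), (T - s * r); split.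
  by rewrite mulr_ge0 // expR_ge0.
move=> t Tt; rewrite -mulrA -expRD -mulrDr -mdiff_flowDc // flowDc //.
have -> : s * t + r = s * (s * r + t) by rewrite mulrDr mulrA ss mul1r addrC.
by apply: vP; lra.
Qed.

Definition exponent_along s p v t := finite_time_exponent g Phi (s * t) p v.

(** The rate is doubled because [growth] measures squared norms. *)
Lemma exponent_growth s c T p v : `|s| = 1 -> complete_at Phi p ->
  (forall t, T < t -> (exponent_along s p v t < c%:E)%E) -> growth s (2 * c) p v.
Proof.
move=> s1 pT vP; exists (g p v v), (Num.max T 0); split; first exact: metric_ge0.
move=> t; rewrite gt_max => /andP[/vP + t0].
rewrite /exponent_along /finite_time_exponent; have [->|v0] := eqVneq v 0.
  by rewrite linear0 !metric0 mul0r.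
set w := mdiff _ p v; have w0 : w != 0.
  apply: contra_neq v0 => w0; apply: (mdiff_flow_inj pT (t := s * t)).
  by rewrite linear0.
rewrite lte_fin normrM s1 mul1r (gtr0_norm t0) mulrC ltr_pdivrMr // /tangent_norm.
have vv := @metric_pos _ _ _ g p _ v0.
have ww := @metric_pos _ _ _ g (Phi (s * t) p) _ w0.
rewrite -ltr_expR lnK ?posrE ?divr_gt0 ?sqrtr_gt0 // ltr_pdivrMr ?sqrtr_gt0 //.
move=> /ltW; rewrite -(ler_pXn2r (n := 2)) //
  ?nnegrE ?mulr_ge0 ?sqrtr_ge0 ?expR_ge0 //.
rewrite exprMn !sqr_sqrtr ?metric_ge0 // -expRM_natl => /le_trans; apply.
by rewrite mulrC mulrA mulr_natl.
Qed.

(** The constant in front of the exponential contributes a term of order 1 / t to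
    the exponent, which is eventually smaller than [e]. *)
Lemma growth_exponent s c e p v : `|s| = 1 -> complete_at Phi p ->
  v != 0 -> 0 < e -> growth s (2 * c) p v ->
  exists T, forall t, T < t -> (exponent_along s p v t <= (c + e)%:E)%E.
Proof.
move=> s1 pT v0 e0 [K [T [K0 vP]]].
have vv := @metric_pos _ _ _ g p _ v0.
(* K may vanish; K + 1 has a logarithm. *)
set L := ln (Num.sqrt (K + 1) / tangent_norm g p v).
(* L / t is less than e once t exceeds L / e. *)
exists (Num.max (Num.max T 0) (L / e)) => t.
rewrite !gt_max => /andP[/andP[/vP + t0] Lt].
rewrite /exponent_along /finite_time_exponent (negPf v0) lee_fin.
set w := mdiff _ p v; have w0 : w != 0.
  apply: contra_neq v0 => w0; apply: (mdiff_flow_inj pT (t := s * t)).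
  by rewrite linear0.
have ww := @metric_pos _ _ _ g (Phi (s * t) p) _ w0 => wK.
rewrite normrM s1 mul1r (gtr0_norm t0) mulrC ler_pdivrMr //.
apply: (@le_trans _ _ (L + c * t)); last first.
  by rewrite mulrDl addrC lerD2l mulrC -ler_pdivrMr // ltW.
have N0 : 0 < tangent_norm g p v by rewrite sqrtr_gt0.
have K1' : 0 < K + 1 by lra.
have K1 : 0 < Num.sqrt (K + 1) by rewrite sqrtr_gt0.
rewrite -[X in _ <= _ + X](expRK) -lnM ?posrE ?divr_gt0 ?expR_gt0 //.
rewrite ler_ln ?posrE ?mulr_gt0 ?invr_gt0 ?sqrtr_gt0 ?expR_gt0 //.
rewrite mulrAC ler_pM2r ?invr_gt0 //.
rewrite -(ler_pXn2r (n := 2)) // ?nnegrE ?mulr_ge0 ?sqrtr_ge0 ?expR_ge0 //.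
rewrite exprMn !sqr_sqrtr ?(ltW ww) ?(ltW K1') //.
apply: le_trans wK _; rewrite -expRM_natl mulr_natl -mulr_natl mulrA.
by rewrite ler_wpM2r ?expR_ge0 //; lra.
Qed.

Lemma forward_lt_growth p v c : complete_at Phi p ->
  (forward_exponent g Phi p v < c%:E)%E -> growth 1 (2 * c) p v.
Proof.
move=> pT; rewrite /forward_exponent pT => /limf_esup_lt[A [T _ TA] At].
apply: (@exponent_growth 1 c T); rewrite ?normr1 // => t Tt.
rewrite /exponent_along mul1r; by apply: At; apply: TA.
Qed.

Lemma backward_lt_growth p v c : complete_at Phi p ->
  (backward_exponent g Phi p v < c%:E)%E -> growth (-1) (2 * c) p v.
Proof.
move=> pT; rewrite /backward_exponent pT => /limf_esup_lt[A [T _ TA] At].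
apply: (@exponent_growth (-1) c (- T)); rewrite ?normrN1 // => t Tt.
rewrite /exponent_along mulN1r; by apply: At; apply: TA; split=> //; lra.
Qed.

Lemma growth_forward_le p v c c' : complete_at Phi p -> v != 0 -> c < c' ->
  growth 1 (2 * c) p v -> (forward_exponent g Phi p v <= c'%:E)%E.
Proof.
move=> pT v0 cc' /(growth_exponent (e := c' - c))[]; rewrite ?normr1 // ?subr_gt0 //.
move=> T TP; rewrite /forward_exponent pT.
apply: (@limf_esup_le _ _ _ [set t | setT t /\ T < t]); first by exists T.
by move=> t [_ /TP]; rewrite /exponent_along mul1r [c + _]addrC subrK.
Qed.

Lemma growth_backward_le p v c c' : complete_at Phi p -> v != 0 -> c < c' ->
  growth (-1) (2 * c) p v -> (backward_exponent g Phi p v <= c'%:E)%E.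
Proof.
move=> pT v0 cc' /(growth_exponent (e := c' - c))[]; rewrite ?normrN1 // ?subr_gt0 //.
move=> T TP; rewrite /backward_exponent pT.
apply: (@limf_esup_le _ _ _ [set t | setT t /\ t < - T]); first by exists (- T).
move=> t [_ tT]; have := TP (- t).
by rewrite /exponent_along mulN1r opprK [c + _]addrC subrK; apply; lra.
Qed.

(** Of the two rates one is the larger, and growth at a rate implies growth at
    any larger one. Hence one of [D'] and the image of [D] contains the other,
    and their dimensions agree. *)
Lemma growth_transport s c c' r p (D D' : {vspace 'rV[R]_m}) : s * s = 1 ->
  complete_at Phi p -> \dim D = \dim D' ->
  (forall v, v \in D <-> growth s c p v) ->
  (forall v, v \in D' <-> growth s c' (Phi r p) v) ->
  (linfun (mdiff (Phi r) p) @: D)%VS = D'.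
Proof.
move=> ss pT dD DP D'P.
have lker q t (qT : complete_at Phi q) :
    lker (linfun (mdiff (Phi t) q)) == 0%VS.
  by apply/lker0P => u v; rewrite !lfunE => /(mdiff_flow_inj qT).
have dimE q t (qT : complete_at Phi q) U :
    \dim (linfun (mdiff (Phi t) q) @: U) = \dim U.
  by apply: limg_dim_eq; rewrite (eqP (lker q t qT)) capv0.
have [cc'|/ltW c'c] := leP c c'.
  apply/eqP; rewrite eqEdim dimE // dD leqnn andbT; apply/subvP => _ /memv_imgP[u uD ->].
  by rewrite lfunE; apply/D'P/(growth_le cc')/growth_flow => //; apply/DP.
apply/esym/eqP; rewrite eqEdim dimE // dD leqnn andbT; apply/subvP => u uD'.
have qT := complete_flow r pT.
pose w := mdiff (Phi (- r)) (Phi r p) u.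
have wu : mdiff (Phi r) p w = u.
  have pE : Phi (- r) (Phi r p) = p by rewrite flowDc // addNr flow0.
  apply: etrans (congr1 (fun q => mdiff (Phi r) q w) (esym pE)) _.
  apply: etrans (esym (mdiff_flowDc (- r) r u qT)) _.
  rewrite addrN; exact: mdiff_flow0.
apply/memv_imgP; exists w; last by rewrite lfunE.
apply/DP; have := growth_flow (- r) ss qT (iffLR (D'P u) uD').
by rewrite flowDc // addNr flow0; exact: growth_le.
Qed.

End Growth.

(** The component along [F] of a vector satisfying [P] satisfies [P] as well, so
    it vanishes. *)
Lemma splitting_growth (R : realType) n (E F : {vspace 'rV[R]_n})
    (P : 'rV[R]_n -> Prop) :
  (forall a u v, P u -> P v -> P (a *: u + v)) ->
  (forall v, v \in E -> P v) -> (forall v, v \in F -> P v -> v = 0) ->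
  (E + F)%VS = fullv -> forall v, v \in E <-> P v.
Proof.
move=> Plin PE PF EF v; split=> [/PE//|Pv].
have : v \in (E + F)%VS by rewrite EF memvf.
move=> /memv_addP[e eE [f fF vE]].
have Pf : P f.
  have -> : f = (-1) *: e + v by rewrite vE scaleN1r addKr.
  by apply: Plin => //; exact: PE.
by rewrite vE (PF f fF Pf) addr0.
Qed.

(** * Continuous subbundles for a coinduced topology *)

Section MatrixContinuity.
Context {R : realType} {Y : topologicalType}.

Lemma continuous_ext_at (V : topologicalType) (f h : Y -> V) z :
  f =1 h -> {for z, continuous f} -> {for z, continuous h}.
Proof. by move=> /funext ->. Qed.

Lemma continuous_sum_at (V : normedModType R) (I : finType) (f : I -> Y -> V) z :
  (forall i, {for z, continuous (f i)}) -> {for z, continuous (fun y => \sum_i f i y)}.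
Proof.
by move=> fc; apply: cvg_big => [|i _]; [exact: add_continuous|exact: fc].
Qed.

Lemma continuous_prod_at (I : finType) (f : I -> Y -> R^o) z :
  (forall i, {for z, continuous (f i)}) ->
  {for z, continuous (fun y => \prod_i f i y : R^o)}.
Proof.
by move=> fc; apply: cvg_big => [|i _]; [exact: mul_continuous|exact: fc].
Qed.

Lemma continuous_det n (B : Y -> 'M[R]_n) z :
  (forall i l, {for z, continuous (fun y => B y i l : R^o)}) ->
  {for z, continuous (fun y => \det (B y) : R^o)}.
Proof.
move=> Bc; apply: continuous_sum_at => s.
have c1 : {for z, continuous (fun _ : Y => (-1) ^+ (perm.odd_perm s) : R^o)}.
  exact: cst_continuous.
by apply: (cvgM c1); apply: continuous_prod_at.
Qed.

Lemma near_unitmx n (B : Y -> 'M[R]_n) z :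
  (forall i l, {for z, continuous (fun y => B y i l : R^o)}) ->
  B z \in unitmx -> \forall y \near z, B y \in unitmx.
Proof.
move=> Bc; rewrite unitmxE unitfE => Bz.
have N : \forall y \near z, \det (B y) != 0 :=
  @cvgr_neq0 _ R^o _ (nbhs z) (nbhs_filter z) _ _ (continuous_det Bc) Bz.
by apply: filterS N => y By; rewrite unitmxE unitfE.
Qed.

Lemma continuous_invmx n (B : Y -> 'M[R]_n) z i l :
  (forall i l, {for z, continuous (fun y => B y i l : R^o)}) ->
  B z \in unitmx -> {for z, continuous (fun y => invmx (B y) i l : R^o)}.
Proof.
move=> Bc Bz; have nB := near_unitmx Bc Bz.
have E y : B y \in unitmx -> (\det (B y))^-1 * cofactor (B y) l i = invmx (B y) i l.
  by move=> By; rewrite /invmx By !mxE.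
have K : {for z, continuous (fun y => (\det (B y))^-1 * cofactor (B y) l i : R^o)}.
  apply: cvgM.
    by apply: cvgV; [rewrite -unitfE -unitmxE|exact: continuous_det].
  rewrite /cofactor; apply: cvgM; first exact: cst_continuous.
  apply: continuous_det => i' l'.
  by apply: continuous_ext_at (Bc (lift l i') (lift i l')) => y; rewrite !mxE.
by apply: continuous_near_eq K; apply: filterS nB => y /E.
Qed.

End MatrixContinuity.

Lemma basis_of_tupleP (R : realType) n k (D : {vspace 'rV[R]_n})
    (u : 'I_k -> 'rV[R]_n) :
  \dim D = k -> (forall i, u i \in D) ->
  (forall c : 'I_k -> R, \sum_i c i *: u i = 0 -> forall i, c i = 0) ->
  basis_of D [tuple u i | i < k].
Proof.
move=> dimD uD u_free; rewrite basisEfree size_tuple dimD leqnn andbT; apply/andP; split.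
  apply/freeP => c; under eq_bigr do rewrite -tnth_nth tnth_mktuple.
  exact: u_free.
by apply/span_subvP => _ /mapP[i _ ->].
Qed.

Lemma basis_of_tuple_coords (R : realType) n k (D : {vspace 'rV[R]_n})
    (u : 'I_k -> 'rV[R]_n) :
  basis_of D [tuple u i | i < k] ->
  [/\ \dim D = k, forall i, u i \in D,
    forall c : 'I_k -> R, \sum_i c i *: u i = 0 -> forall i, c i = 0 &
    forall v, v \in D -> exists c : 'I_k -> R, v = \sum_i c i *: u i].
Proof.
move=> bu; have E (c : 'I_k -> R) :
    \sum_i c i *: [tuple u i | i < k]`_i = \sum_i c i *: u i.
  by apply: eq_bigr => i _; rewrite -tnth_nth tnth_mktuple.
split.
- exact: size_basis bu.
- by move=> i; apply: (basis_mem bu); apply: map_f; rewrite mem_enum.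
- by move=> c; rewrite -E; exact/freeP/basis_free/bu.
- by move=> v /(coord_basis bu); rewrite E => ->; eexists.
Qed.

Section CoinducedSubbundle.
Context {R : realType} {m : nat} {M : smooth_manifold R m} {Y : topologicalType}.
Context (j : Y -> M) (k : nat) (E : M -> {vspace 'rV[R]_m}).
Hypothesis jc : continuous j.

(** Sections of the pull-back of [E] along [j]: [tau i] may take different values at
    two points of [Y] with the same image. *)
Definition pullback_frame (O : set Y) (tau : 'I_k -> Y -> 'rV[R]_m) : Prop :=
  [/\ open O, forall z, O z -> basis_of (E (j z)) [tuple tau i z | i < k] &
      forall i b, atlas M b -> forall z, O z -> cdom b (j z) ->
        {for z, continuous (fun z' => tangent_coord (M := M) b (j z') (tau i z'))}].

Hypothesis frames : forall z, exists O tau, O z /\ pullback_frame O tau.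

Section Local.
Context (b : chart R M m) (Q : 'M[R]_(m, k)).
Hypothesis bA : atlas M b.

(** The condition refers to the point of [M] only, so the preimage of this set
    under [j] is saturated, as the coinduced topology requires. *)
Definition transverse : set M := [set y | [/\ range j y, cdom b y &
  forall u, u \in E y -> tangent_coord (M := M) b y u *m Q = 0 -> u = 0]].

Definition frame_mx (tau : 'I_k -> Y -> 'rV[R]_m) (z : Y) : 'M[R]_(k, m) :=
  \matrix_i tangent_coord (M := M) b (j z) (tau i z).

Lemma frame_mx_sum tau z (c : 'rV[R]_k) :
  tangent_coord (M := M) b (j z) (\sum_i c 0 i *: tau i z) = c *m frame_mx tau z.
Proof.
rewrite tangent_coord_sum mulmx_sum_row; apply: eq_bigr => i _.
by rewrite rowK.
Qed.

(** The kernel of [Q] misses the fibre exactly when [Q] is injective on it, that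
    is, when the images under [Q] of a frame of the fibre form an invertible
    matrix. *)
Lemma transverse_unit O tau z : pullback_frame O tau -> O z -> cdom b (j z) ->
  transverse (j z) <-> frame_mx tau z *m Q \in unitmx.
Proof.
move=> [_ tb _] Oz bz; have [dimE tE tfree tspan] := basis_of_tuple_coords (tb z Oz).
split.
  move=> [_ _ tr]; rewrite -row_free_unit -kermx_eq0; apply/eqP/row_matrixP => i.
  rewrite row0; set c := row i _.
  have cAQ : c *m (frame_mx tau z *m Q) = 0.
    by rewrite /c -row_mul mulmx_ker row0.
  apply/rowP => l; rewrite [RHS]mxE; apply: (tfree (fun l => c 0 l)).
  apply: tr; first by apply: memv_suml => i' _; exact/memvZ/tE.
  by rewrite frame_mx_sum -mulmxA.
move=> AQ; split; [by exists z|by []|].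
move=> u /tspan[c ->].
have -> : \sum_i c i *: tau i z = \sum_i (\row_i c i) 0 i *: tau i z.
  by apply: eq_bigr => i _; rewrite mxE.
rewrite frame_mx_sum -mulmxA => /(congr1 (mulmxr (invmx (frame_mx tau z *m Q)))) /=.
rewrite mulmxK // mul0mx => ->; apply: big1 => i _; by rewrite mxE scale0r.
Qed.

Lemma continuous_frame_mxQ O tau z i l : pullback_frame O tau -> O z ->
  cdom b (j z) -> {for z, continuous (fun z' => (frame_mx tau z' *m Q) i l : R^o)}.
Proof.
move=> [_ _ tc] Oz bz.
pose f z' := \sum_h tangent_coord (M := M) b (j z') (tau i z') 0 h * Q h l.
apply: (@continuous_ext_at _ _ f).
  by move=> z'; rewrite mxE; apply: eq_bigr => h _; rewrite mxE.
apply: continuous_sum_at => h; apply: cvgM; last exact: cst_continuous.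
apply: (@continuous_comp _ _ _ (fun z' => tangent_coord (M := M) b (j z') (tau i z'))
  (fun w : 'rV[R]_m => w 0 h : R^o)); first exact: tc.
exact: coord_continuous.
Qed.

Lemma open_transverse : open (j @^-1` transverse).
Proof.
rewrite openE => z zW; have [_ bz _] := zW.
have [V [tau [Oz tf]]] := frames z.
have unitAQ := iffLR (transverse_unit tf Oz bz) zW.
have n1 := near_unitmx (fun i l => continuous_frame_mxQ tf Oz bz) unitAQ.
have n2 : \forall z' \near z, V z'.
  by apply: open_nbhs_nbhs; split=> //; case: tf.
have n3 : \forall z' \near z, cdom b (j z').
  exact: near_cdom (@jc z) bz.
apply: filterS3 n1 n2 n3 => z' AQ' Oz' bz'.
exact/(transverse_unit tf Oz' bz').
Qed.

(** Where the fibre is transverse to the kernel of [Q], exactly one vector of the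
    fibre satisfies the condition. *)
Definition dual_frame (i : 'I_k) (y : M) : 'rV[R]_m :=
  xget 0 [set u | u \in E y /\ tangent_coord (M := M) b y u *m Q = delta_mx 0 i].

(** Although a pulled-back frame is used to compute it, the result is the same
    for all of them: this is how a frame descends from [Y] to its image. *)
Lemma dual_frameE O tau z i : pullback_frame O tau -> O z -> transverse (j z) ->
  dual_frame i (j z) = \sum_l invmx (frame_mx tau z *m Q) i l *: tau l z.
Proof.
move=> tf Oz tz; have [_ bz tr] := tz.
have unitAQ := iffLR (transverse_unit tf Oz bz) tz.
have [_ tb _] := tf; have [_ tE _ _] := basis_of_tuple_coords (tb z Oz).
set u := RHS; have uE : u \in E (j z).
  by apply: memv_suml => l _; exact/memvZ/tE.
have uQ : tangent_coord (M := M) b (j z) u *m Q = delta_mx 0 i.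
  have -> : u = \sum_l (row i (invmx (frame_mx tau z *m Q))) 0 l *: tau l z.
    by apply: eq_bigr => l _; rewrite mxE.
  by rewrite frame_mx_sum -mulmxA -row_mul mulVmx // row1.
have [|dE dQ] := @xgetPex _ (0 : 'rV[R]_m)
  [set u | u \in E (j z) /\ tangent_coord (M := M) b (j z) u *m Q = delta_mx 0 i].
  by exists u.
apply/eqP; rewrite -subr_eq0; apply/eqP/tr; first exact: rpredB.
by rewrite tangent_coordB mulmxBl dQ uQ subrr.
Qed.

Lemma dual_frame_basis z : transverse (j z) ->
  basis_of (E (j z)) [tuple dual_frame i (j z) | i < k].
Proof.
move=> tz; have [_ bz tr] := tz; have [V [tau [Oz tf]]] := frames z.
have unitAQ := iffLR (transverse_unit tf Oz bz) tz.
have [_ tb _] := tf; have [dimE tE tfree _] := basis_of_tuple_coords (tb z Oz).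
apply: basis_of_tupleP => //.
  move=> i; rewrite (dual_frameE i tf Oz tz).
  by apply: memv_suml => l _; exact/memvZ/tE.
move=> c; under eq_bigr do rewrite (dual_frameE _ tf Oz tz) scaler_sumr.
rewrite exchange_big /=.
under eq_bigr do (under eq_bigr do rewrite scalerA; rewrite -scaler_suml).
move=> /tfree c0 i.
have : (\row_i c i) *m invmx (frame_mx tau z *m Q) = 0.
  by apply/rowP => l; rewrite !mxE -[RHS](c0 l); apply: eq_bigr => i' _; rewrite mxE.
move=> /(congr1 (mulmxr (frame_mx tau z *m Q))) /=.
by rewrite mulmxKV // mul0mx => /rowP/(_ i); rewrite !mxE.
Qed.

Lemma continuous_dual_frame i c z : atlas M c -> transverse (j z) -> cdom c (j z) ->
  {for z, continuous (fun z' => tangent_coord (M := M) c (j z') (dual_frame i (j z')))}.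
Proof.
move=> cA tz cz; have [_ bz _] := tz; have [V [tau [Oz tf]]] := frames z.
have unitAQ := iffLR (transverse_unit tf Oz bz) tz.
have [oO _ tc] := tf.
have nE : \forall z' \near z, \sum_l invmx (frame_mx tau z' *m Q) i l *:
    tangent_coord (M := M) c (j z') (tau l z') =
    tangent_coord (M := M) c (j z') (dual_frame i (j z')).
  have n1 : \forall z' \near z, V z' by apply: open_nbhs_nbhs.
  have n2 : \forall z' \near z, transverse (j z').
    apply: (@open_nbhs_nbhs _ z (j @^-1` transverse)).
    by split=> //; exact: open_transverse.
  apply: filterS2 n1 n2 => z' Oz' tz'.
  by rewrite (dual_frameE _ tf Oz' tz') tangent_coord_sum.
have ic (l : 'I_k) :
    {for z, continuous (fun z' => invmx (frame_mx tau z' *m Q) i l : R^o)}.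
  by apply: continuous_invmx => // i1 i2; exact: (continuous_frame_mxQ tf).
apply: (continuous_near_eq nE).
by apply: continuous_sum_at => l; apply: cvgZ; [exact: ic|exact: tc].
Qed.

End Local.

(** Any right inverse [Q] of the matrix of a frame at one point is transverse to
    the fibre there, hence on a neighbourhood, where it singles out a frame that
    descends. *)
Lemma coinduced_subbundle : continuous_subbundle j k E.
Proof.
move=> _ [z _ <-]; have [V [tau [Oz tf]]] := frames z.
set b := chart_at (j z).
have bA : atlas M b := chart_at_atlas _; have bz : cdom b (j z) := mem_chart_at _.
have [_ tb _] := tf; have [_ _ tfree _] := basis_of_tuple_coords (tb z Oz).
have : row_free (frame_mx b tau z).
  rewrite -kermx_eq0; apply/eqP/row_matrixP => i.
  rewrite row0; set c := row i _.
  have cA : c *m frame_mx b tau z = 0 by rewrite /c -row_mul mulmx_ker row0.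
  apply/rowP => l; rewrite [RHS]mxE; apply: (tfree (fun l => c 0 l)).
  apply: (tangent_coord_inj bA bz); rewrite frame_mx_sum cA.
  by have := tangent_coordB b (j z) 0 0; rewrite !subrr => ->.
move=> /row_freeP[Q AQ].
exists (transverse b Q), (dual_frame b Q); split.
- by move=> y [].
- exact: open_transverse.
- by apply/(transverse_unit _ tf Oz bz); rewrite AQ unitmx1.
- move=> y ty; have [[z' _ z'y] _ _] := ty.
  by rewrite -z'y in ty *; exact: dual_frame_basis.
- by move=> i c cA z' [tz' cz']; exact: continuous_dual_frame.
Qed.

End CoinducedSubbundle.

(** * Transporting a bundle along the flow *)

(** Written as a time derivative of the flow in a fixed chart, the generator
    visibly depends continuously on the point. *)
Lemma tangent_coord_generator (R : realType) n (M : smooth_manifold R n)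
    (Phi : smooth_flow M) (b : chart R M n) p : atlas M b -> cdom b p ->
  tangent_coord (M := M) b p (generator Phi p) =
  'd (cmap b \o flow_chart Phi b) (0 : R^o, cmap b p) (1 : R^o, 0).
Proof.
move=> bA bp; set x := cmap b p; have xK : cinv b x = p := cmapK bp.
have dom : flow_chart_dom Phi b (0 : R^o, x).
  by split; [exact: cmap_cod|rewrite /= xK; exact: flow_dom0].
have fd := diffable_flow_chart bA dom.
have [d1 d1E] := diff_slicel (0 : R^o) x.
have [hd hE] := diff_into_precomp d1 fd.
have fE : flow_chart Phi b \o (fun s : R^o => (s, x)) = fun s : R^o => Phi s p.
  by apply/funext => s; rewrite /flow_chart /= xK.
have XE : generator Phi p = diff_into (flow_chart Phi b) (0 : R^o, x) (1 : R^o, 0).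
  apply: etrans (congr1 (fun f : R^o -> M => diff_into f 0 1) (esym fE)) _.
  exact: etrans (hE 1) (congr1 _ (d1E 1)).
have x0 : flow_chart Phi b (0 : R^o, x) = p by rewrite /flow_chart /= xK flow0.
have E := @tangent_coord_diff_into _ _ _ _ _ _ b (1 : R^o, 0) fd bA; rewrite x0 in E.
exact: etrans (congr1 _ XE) (E bp).
Qed.

Section Transport.
Context {R : realType} {m d : nat}.
Context {M : smooth_manifold R m} {S : smooth_manifold R d}.
Context (Phi : smooth_flow M) (iota : S -> M).
Hypothesis iotas : smooth_map iota.
Hypothesis Sc : forall p, complete_at Phi (iota p).

Lemma near_iota (b : chart R M m) (q : S) : cdom b (iota q) ->
  \forall q' \near q, cdom b (iota q').
Proof.
exact: near_cdom (mdiffable_continuous (smooth_map_mdiffable q iotas)).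
Qed.

Definition flow_coord (a : chart R M m) (z : R * S) : R^o * 'rV[R]_m :=
  (z.1, cmap a (iota z.2)).

Lemma flow_coord_dom (a : chart R M m) z : cdom a (iota z.2) ->
  flow_chart_dom Phi a (flow_coord a z).
Proof. by move=> az; split; [exact: cmap_cod|rewrite /= cmapK // Sc]. Qed.

Lemma flow_coordK (a : chart R M m) z : cdom a (iota z.2) ->
  flow_chart Phi a (flow_coord a z) = flowout Phi iota z.
Proof. by move=> az; rewrite /flow_chart /= cmapK. Qed.

Lemma continuous_snd_comp (V : topologicalType) (f : S -> V) (z : R * S) :
  {for z.2, continuous f} -> {for z, continuous (f \o snd)}.
Proof. by move=> fc; apply: continuous_comp => //; exact: cvg_snd. Qed.

Lemma continuous_flow_coord (a : chart R M m) z : cdom a (iota z.2) ->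
  {for z, continuous (flow_coord a)}.
Proof.
move=> az; apply: continuous_pair; first exact: cvg_fst.
apply: (@continuous_snd_comp _ (cmap a \o iota)); apply: continuous_comp.
  exact: mdiffable_continuous (smooth_map_mdiffable _ iotas).
exact: cmap_continuous.
Qed.

Lemma near_cdom_snd (a : chart R M m) (z : R * S) : cdom a (iota z.2) ->
  \forall z' \near z, cdom a (iota z'.2).
Proof. by move=> /near_iota; exact: cvg_snd. Qed.

Lemma continuous_flowout : continuous (flowout Phi iota).
Proof.
move=> z; set a := chart_at (iota z.2).
have aA : atlas M a := chart_at_atlas _.
have az : cdom a (iota z.2) := mem_chart_at _.
have K : {for z, continuous (flow_chart Phi a \o flow_coord a)}.
  apply: continuous_comp; first exact: continuous_flow_coord.
  by have [] := diffable_flow_chart aA (flow_coord_dom az).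
apply: continuous_near_eq K; apply: filterS (near_cdom_snd az) => z'.
exact: flow_coordK.
Qed.

(** In a chart, the transported vector is the differential of the flow, as a map of
    time and position, in the direction (0, w) with w continuous. Expanding w
    along the standard basis leaves partial derivatives of the flow, which are
    jointly continuous in time and position. *)
Lemma continuous_transport (sigma : S -> 'rV[R]_m) (z : R * S) (b : chart R M m) :
  (forall a, atlas M a -> cdom a (iota z.2) ->
    {for z.2, continuous (fun q => tangent_coord (M := M) a (iota q) (sigma q))}) ->
  atlas M b -> cdom b (flowout Phi iota z) ->
  {for z, continuous (fun z' => tangent_coord (M := M) b (flowout Phi iota z')
     (mdiff (Phi z'.1) (iota z'.2) (sigma z'.2)))}.
Proof.
move=> sc bA bz; set a := chart_at (iota z.2).
have aA : atlas M a := chart_at_atlas _.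
have az : cdom a (iota z.2) := mem_chart_at _.
pose h := cmap b \o flow_chart Phi a.
have [hd hc] : Ck_on 1 (flow_chart_dom Phi a `&` flow_chart Phi a @^-1` cdom b) h :=
  (@flow_smooth _ _ _ Phi _ aA).2 b bA 1%N.
pose w (z' : R * S) := tangent_coord (M := M) a (iota z'.2) (sigma z'.2).
pose D i (z' : R * S) := 'd h (flow_coord a z') (0 : R^o, delta_mx 0 i).
have near_dom : \forall z' \near z,
    cdom a (iota z'.2) /\ cdom b (flowout Phi iota z').
  apply: filterI; first exact: near_cdom_snd.
  exact: near_cdom (@continuous_flowout z) bz.
have E z' : cdom a (iota z'.2) -> cdom b (flowout Phi iota z') ->
    \sum_i w z' 0 i *: D i z' =
    tangent_coord (M := M) b (flowout Phi iota z')
      (mdiff (Phi z'.1) (iota z'.2) (sigma z'.2)).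
  move=> az' bz'; have dP : mdiffable (Phi z'.1) (iota z'.2).
    by apply: mdiffable_flow; rewrite Sc.
  apply: etrans _ (esym (tangent_coord_mdiff _ dP aA bA az' bz')).
  have dh : differentiable h (z'.1 : R^o, cmap a (iota z'.2)).
    apply: hd; split; first exact: flow_coord_dom.
    by rewrite /= /flow_chart /= cmapK.
  have [d1 d1E] := diff_slicer (z'.1 : R^o) (cmap a (iota z'.2)).
  apply: etrans _ (esym (diff_compE _ d1 dh)).
  rewrite d1E -/(w z').
  have -> : (0 : R^o, w z') = \sum_i w z' 0 i *: (0 : R^o, delta_mx 0 i).
    rewrite {1}(row_sum_delta (w z')); elim/big_rec2: _ => // i y1 y2 _ <-.
    by congr pair; rewrite /= ?scaler0 ?addr0.
  by rewrite linear_sum; apply: eq_bigr => i _; rewrite linearZ.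
have K : {for z, continuous (fun z' => \sum_i w z' 0 i *: D i z')}.
  apply: continuous_sum_at => i; apply: cvgZ.
    apply: (@continuous_comp _ _ _ w (fun u : 'rV[R]_m => u 0 i : R^o)).
      exact: (@continuous_snd_comp _
        (fun q => tangent_coord a (iota q) (sigma q)) z (sc a aA az)).
    exact: coord_continuous.
  apply: (@continuous_comp _ _ _ (flow_coord a)
    (fun y => 'd h y (0 : R^o, delta_mx 0 i))).
    exact: continuous_flow_coord.
  apply: hc; split; first exact: flow_coord_dom.
  by rewrite /= flow_coordK.
by apply: continuous_near_eq K; apply: filterS near_dom => z' [? ?]; exact: E.
Qed.

Definition frame_along k (D : S -> {vspace 'rV[R]_m}) : Prop :=
  forall p, exists (U : set S) (sigma : 'I_k -> S -> 'rV[R]_m),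
    [/\ open U, U p, forall q, U q -> basis_of (D q) [tuple sigma i q | i < k] &
      forall i b q, atlas M b -> U q -> cdom b (iota q) ->
        {for q, continuous (fun q => tangent_coord (M := M) b (iota q) (sigma i q))}].

Definition push (t : R) (p : S) (V : {vspace 'rV[R]_m}) : {vspace 'rV[R]_m} :=
  (linfun (mdiff (Phi t) (iota p)) @: V)%VS.

Lemma push_ker t p : lker (linfun (mdiff (Phi t) (iota p))) == 0%VS.
Proof. by apply/lker0P => u v; rewrite !lfunE => /(mdiff_flow_inj (Sc p)). Qed.

Lemma flow_push s t p V :
  (linfun (mdiff (Phi t) (Phi s (iota p))) @: push s p V)%VS = push (t + s) p V.
Proof.
apply: etrans (esym (limg_comp _ _ _)) (congr1 (fun f => f @: V)%VS _).
apply/lfunP => v; apply: etrans (comp_lfunE _ _ _) _.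
apply: etrans (lfunE _ _) (etrans (congr1 _ (lfunE _ _)) _).
exact: etrans (esym (mdiff_flowDc s t v (Sc p))) (esym (lfunE _ _)).
Qed.

Lemma push0 p V : push 0 p V = V.
Proof.
apply: etrans (congr1 (fun f => f @: V)%VS _) (lim1g V).
apply/lfunP => v; apply: etrans (lfunE _ _) (etrans _ (esym (id_lfunE v))).
exact: mdiff_flow0.
Qed.

Definition flow_extension (D : S -> {vspace 'rV[R]_m}) (E : M -> {vspace 'rV[R]_m}) :=
  forall t p, E (flowout Phi iota (t, p)) = push t p (D p).

(** Two parameters of one point of the image differ by a return of the orbit to
    [S]. *)
Lemma flow_extension_exists (D : S -> {vspace 'rV[R]_m}) :
  (forall r p q, Phi r (iota p) = iota q -> push r p (D p) = D q) ->
  exists E, flow_extension D E.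
Proof.
move=> Dinv.
have H x : exists V, forall t p, flowout Phi iota (t, p) = x -> V = push t p (D p).
  have [[t0 [p0 x0]]|N] := pselect (exists t p, flowout Phi iota (t, p) = x); last first.
    by exists 0%VS => t p tp; case: N; exists t, p.
  exists (push t0 p0 (D p0)) => t p tp.
  (* The orbit of p returns to S, at p0, after the time t - t0. *)
  have E : Phi (t - t0) (iota p) = iota p0.
    have : Phi (- t0) (flowout Phi iota (t, p)) = Phi (- t0) (flowout Phi iota (t0, p0)).
      by rewrite tp x0.
    by rewrite /flowout /= !flowDc // addNr flow0 addrC.
  rewrite -(Dinv _ _ _ E) {1}/push -E.
  by rewrite flow_push addrC subrK.
by have [E EP] := choice H; exists E => t p; exact: EP.
Qed.

Lemma flow_extension_invariant D E : flow_extension D E ->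
  invariant_subbundle Phi iota E.
Proof.
move=> DE _ t [[s p] _ <-]; rewrite DE {1}/flowout /= flow_push.
by rewrite {1}/flowout /= flowDc // -(DE (t + s) p).
Qed.

Lemma flow_extension_unique D E E' : flow_extension D E ->
  (forall p, E' (iota p) = D p) -> invariant_subbundle Phi iota E' ->
  forall x, range (flowout Phi iota) x -> E' x = E x.
Proof.
move=> DE E'D E'inv _ [[t p] _ <-]; rewrite DE /flowout /=.
have pN : range (flowout Phi iota) (iota p).
  by exists (0, p); rewrite // /flowout /= flow0.
by rewrite -(E'inv _ t pN) E'D.
Qed.

Lemma flow_extension_restr D E : flow_extension D E -> forall p, E (iota p) = D p.
Proof.
by move=> DE p; have := DE 0 p; rewrite push0 /flowout /= flow0.
Qed.

Lemma flow_extension_continuous k D E : frame_along k D -> flow_extension D E ->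
  continuous_subbundle (flowout Phi iota) k E.
Proof.
move=> Dfr DE; apply: coinduced_subbundle; first exact: continuous_flowout.
move=> [t p]; have [U [sigma [oU Up sb sc]]] := Dfr p.
exists [set z | U z.2], (fun i z => mdiff (Phi z.1) (iota z.2) (sigma i z.2)).
split=> //; split.
- rewrite (_ : mkset _ = setT `&` (snd : R * S -> S) @^-1` U); last by rewrite setTI.
  by apply: open_setI_preimage; [exact: openT|exact: oU|move=> z _; exact: cvg_snd].
- move=> [s q] /= Uq; rewrite (DE s q).
  have := limg_basis_of (f := linfun (mdiff (Phi s) (iota q))) _ (sb q Uq).
  rewrite (eqP (push_ker s q)) capv0 => /(_ erefl).
  congr (basis_of _ _); rewrite /= -map_comp; apply: eq_map => i /=; exact: lfunE.
- move=> i b bA z Uz bz; apply: continuous_transport => // a aA az.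
  exact: sc.
Qed.

Lemma flow_extension_split D1 D2 E1 E2 :
  flow_extension D1 E1 -> flow_extension D2 E2 ->
  (forall p, (D1 p :&: D2 p)%VS = 0%VS /\ (D1 p + D2 p)%VS = fullv) ->
  forall x, range (flowout Phi iota) x ->
    directv (E1 x + E2 x) /\ (E1 x + E2 x)%VS = fullv.
Proof.
move=> DE1 DE2 D12 _ [[t p] _ <-]; rewrite DE1 DE2; have [D0 DT] := D12 p.
split.
  apply/directv_addP; rewrite /push -(lker0_img_cap _ _ (push_ker t p)) D0.
  exact: limg0.
rewrite /push -limgD DT; apply/eqP; rewrite eqEdim subvf.
have := @limg_dim_eq _ _ _ (linfun (mdiff (Phi t) (iota p))) fullv.
by rewrite (eqP (push_ker t p)) capv0 => /(_ erefl) -> /=.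
Qed.

End Transport.

(** * The invariant splitting *)

Section TangentAndSubbundles.
Context {R : realType} {m d : nat}.
Context {M : smooth_manifold R m} {S : smooth_manifold R d}.
Context (Phi : smooth_flow M) (iota : S -> M).
Hypothesis iota_embedding : smooth_embedding iota.
Hypothesis X_nowhere_tangent :
  forall p : S, generator Phi (iota p) \notin submanifold_tangent iota p.

Let iotas : smooth_map iota := embedding_smooth iota_embedding.

Lemma generator_neq0 p : generator Phi (iota p) != 0.
Proof. by apply: contraNneq (X_nowhere_tangent p) => ->; exact: mem0v. Qed.

Lemma dim_submanifold_tangent p : \dim (submanifold_tangent iota p) = d.
Proof.
have := @limg_dim_eq _ _ _ (linfun (mdiff iota p)) fullv.
have /eqP -> : lker (linfun (mdiff iota p)) == 0%VS.
  apply/lker0P => u v; rewrite !lfunE.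
  exact: (embedding_immersion iota_embedding).
by rewrite capv0 => /(_ erefl) ->; rewrite dimvf /dim /= mul1n.
Qed.

Lemma generator_tangent_cap p :
  (<[generator Phi (iota p)]> :&: submanifold_tangent iota p = 0)%VS.
Proof.
apply/eqP; rewrite -subv0; apply/subvP => v /memv_capP[/vlineP[c ->] cT].
have [->|c0] := eqVneq c 0; first by rewrite scale0r mem0v.
case/negP: (X_nowhere_tangent p); have := memvZ c^-1 cT.
by rewrite scalerA mulVf // scale1r.
Qed.

Lemma dim_generator_plus_tangent p : \dim (generator_plus_tangent Phi iota p) = d.+1.
Proof.
rewrite dimv_disjoint_sum; last exact: generator_tangent_cap.
by rewrite dim_vline generator_neq0 dim_submanifold_tangent.
Qed.

(** If [c] were not 0, the generator would be tangent to [S]. *)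
Lemma generator_tangent_inj p (c : R) (v : 'rV[R]_d) :
  c *: generator Phi (iota p) + mdiff iota p v = 0 -> c = 0 /\ v = 0.
Proof.
move=> E; have c0 : c = 0.
  apply/eqP; apply: contraT => c0; case/negP: (X_nowhere_tangent p).
  have -> : generator Phi (iota p) = c^-1 *: - mdiff iota p v.
    by move/eqP: E; rewrite addr_eq0 => /eqP <-; rewrite scalerA mulVf // scale1r.
  by rewrite memvZ // memvN -lfunE memv_img // memvf.
split=> //; apply: (embedding_immersion iota_embedding (p := p)).
by rewrite linear0; move: E; rewrite c0 scale0r add0r.
Qed.

Lemma flowout_is_immersion : (forall p, complete_at Phi (iota p)) ->
  flowout_immersion Phi iota.
Proof.
move=> Sc; split; first by move=> a aA; exact: smooth_flowout_chart.
move=> t p [c1 v1] [c2 v2] E.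
have D c v := diff_flowout iotas Sc t p c v.
have {}E := etrans (esym (D c1 v1)) (etrans E (D c2 v2)).
have /eqP := mdiff_flow_inj (Sc p) E; rewrite -subr_eq0 => /eqP {}E.
have [|/eqP + /eqP] := @generator_tangent_inj p (c1 - c2) (v1 - v2).
  by rewrite -[RHS]E linearB scalerBl opprD addrACA.
by rewrite !subr_eq0 => /eqP -> /eqP ->.
Qed.

Lemma smooth_subbundle_frame k (D : S -> {vspace 'rV[R]_m}) :
  smooth_subbundle iota k D -> frame_along iota k D.
Proof.
move=> Ds p; have [U [sigma [oU Up sb sc]]] := Ds p.
exists U, sigma; split=> // i b q bA Uq bq.
set a := chart_at q; have aA : atlas S a := chart_at_atlas q.
have aq : cdom a q := mem_chart_at q.
pose f x := tangent_coord (M := M) b (iota (cinv a x)) (sigma i (cinv a x)).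
have fc : {for cmap a q, continuous f}.
  apply: (sc i a b aA bA 0%N); split; first exact: cmap_cod.
  by rewrite /= cmapK.
have K : {for q, continuous (f \o cmap a)}.
  by apply: continuous_comp => //; exact: cmap_continuous.
apply: continuous_near_eq K.
by apply: filterS (near_cdom cvg_id aq) => q' aq'; rewrite /f /= cmapK.
Qed.

(** The generator, followed by the images of the coordinate vector fields of a
    chart of [S]. *)
Lemma generator_tangent_frame :
  frame_along iota d.+1 (generator_plus_tangent Phi iota).
Proof.
move=> p; set a := chart_at p; have aA : atlas S a := chart_at_atlas p.
(* The i-th coordinate vector field of the chart [a]. *)
pose e i q := diff_into (M := S) (cinv a) (cmap a q) (delta_mx 0 i).
pose sigma (i : 'I_d.+1) q := if unlift ord0 i is Some i' then mdiff iota q (e i' q)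
  else generator Phi (iota q).
exists (cdom a), sigma; split; [exact: cdom_open|exact: mem_chart_at| |].
- move=> q aq; apply: basis_of_tupleP; first exact: dim_generator_plus_tangent.
    move=> i; rewrite /sigma; case: unliftP => [i' _|_].
      apply: (subvP (addvSr _ _)); rewrite -lfunE; exact/memv_img/memvf.
    exact/(subvP (addvSl _ _))/memv_line.
  move=> c; rewrite big_ord_recl /sigma unlift_none => E.
  have {}E : c ord0 *: generator Phi (iota q) +
      mdiff iota q (\sum_i c (lift ord0 i) *: e i q) = 0.
    rewrite -[RHS]E mdiff_sum; congr (_ + _).
    by apply: eq_bigr => i _; rewrite liftK.
  have [c0 s0] := generator_tangent_inj E.
  have cl i : c (lift ord0 i) = 0.
    have := congr1 (tangent_coord (M := S) a q) s0; rewrite tangent_coord_sum.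
    have -> : tangent_coord (M := S) a q 0 = 0.
      by have := tangent_coordB a q 0 0; rewrite !subrr.
    under eq_bigr do rewrite tangent_coordK //.
    move=> /rowP /(_ i); rewrite summxE !mxE => <-.
    rewrite (bigD1 i) //= !mxE !eqxx mulr1 big1 ?addr0 // => i' ne.
    by rewrite !mxE eqxx [i == i']eq_sym (negPf ne) mulr0.
  by move=> i; case: (unliftP ord0 i) => [i' ->|->].
- move=> i b q bA aq bq; rewrite /sigma; case: unliftP => [i' _|_].
    pose f x := 'd (cmap b \o (iota \o cinv a)) x (delta_mx 0 i').
    have [_ fc] := (iotas aA).2 b bA 1%N.
    have K : {for q, continuous (f \o cmap a)}.
      apply: continuous_comp; first exact: cmap_continuous.
      by apply: fc; split; [exact: cmap_cod|rewrite /= cmapK].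
    apply: continuous_near_eq K.
    apply: filterS2 (near_cdom cvg_id aq) (near_iota iotas bq) => q' aq' bq'.
    apply: etrans _ (esym (tangent_coord_mdiff _
      (smooth_map_mdiffable q' iotas) aA bA aq' bq')).
    by rewrite /e tangent_coordK.
  pose f x := 'd (cmap b \o flow_chart Phi b) x (1 : R^o, 0 : 'rV[R]_m).
  have [_ fc] : Ck_on 1 (flow_chart_dom Phi b `&` flow_chart Phi b @^-1` cdom b)
    (cmap b \o flow_chart Phi b) := (@flow_smooth _ _ _ Phi _ bA).2 b bA 1%N.
  have K : {for q, continuous (f \o (fun q' => (0 : R^o, cmap b (iota q'))))}.
    apply: continuous_comp.
      apply: continuous_pair; first exact: cst_continuous.
      apply: continuous_comp; last exact: cmap_continuous.
      exact: mdiffable_continuous (smooth_map_mdiffable q iotas).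
    apply: fc; split; first split.
    - exact: cmap_cod.
    - by rewrite /= cmapK //; exact: flow_dom0.
    - by rewrite /= /flow_chart /= cmapK // flow0.
  apply: continuous_near_eq K; apply: filterS (near_iota iotas bq) => q' bq'.
  exact/esym/tangent_coord_generator.
Qed.

End TangentAndSubbundles.

Theorem theorem12 (R : realType) (m d : nat)
    (M : smooth_manifold R m) (g : riemannian_metric M) (Phi : smooth_flow M)
    (S : smooth_manifold R d) (iota : S -> M)
    (ES : S -> {vspace 'rV[R]_m})
    (g_complete : riemannian_complete g)
    (iota_embedding : smooth_embedding iota)
    (X_nowhere_tangent :
      forall p : S, generator Phi (iota p) \notin submanifold_tangent iota p)
    (flow_dom_S : forall p : S, flow_dom Phi (iota p) = setT)
    (ES_smooth : smooth_subbundle iota (m - d - 1)%N ES)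
    (hyp_a : forall p : S,
      (ereal_sup [set forward_exponent g Phi (iota p) u | u in [set` ES p]]
       < ereal_inf [set forward_exponent g Phi (iota p) v | v in
           [set v | v \in generator_plus_tangent Phi iota p /\ v != 0%R]])%E)
    (hyp_b : forall p : S,
      (ereal_sup [set backward_exponent g Phi (iota p) v | v in
           [set` generator_plus_tangent Phi iota p]]
       < ereal_inf [set backward_exponent g Phi (iota p) u | u in
           [set u | u \in ES p /\ u != 0%R]])%E) :
  flowout_immersion Phi iota /\
  exists E F : M -> {vspace 'rV[R]_m},
    invariant_splitting Phi iota ES E F /\
    forall E' F' : M -> {vspace 'rV[R]_m},
      invariant_splitting Phi iota ES E' F' ->
      forall x, range (flowout Phi iota) x -> E' x = E x /\ F' x = F x.
Proof.
have Sc p : complete_at Phi (iota p) := flow_dom_S p.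
have iotas : smooth_map iota := embedding_smooth iota_embedding.
set FS := generator_plus_tangent Phi iota.
have ES_frame := smooth_subbundle_frame ES_smooth.
have FS_frame := generator_tangent_frame iota_embedding X_nowhere_tangent.
have dimF p : \dim (FS p) = d.+1.
  exact: dim_generator_plus_tangent iota_embedding X_nowhere_tangent p.
have dimE p : \dim (ES p) = (m - d - 1)%N.
  by have [U [sigma [_ Up /(_ p Up)/size_basis]]] := ES_frame p.
have exE (P : {vspace 'rV[R]_m}) v f : v \in P ->
    (f v <= ereal_sup [set f u | u in [set` P]] :> \bar R)%E.
  by move=> vP; apply: le_ereal_sup_tmp; exists (f v) => //; exists v.
have exI (P : {vspace 'rV[R]_m}) v f : v \in P -> v != 0 ->
    (ereal_inf [set f u | u in [set u | u \in P /\ u != 0%R]] <= f v :> \bar R)%E.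
  by move=> vP v0; apply: ge_ereal_inf; exists (f v) => //; exists v.
have cap0 p : (ES p :&: FS p = 0)%VS.
  apply/eqP; rewrite -subv0; apply/subvP => v /memv_capP[vE vF].
  rewrite memv0; apply: contraT => v0.
  have := lt_le_trans (le_lt_trans (exE _ _ _ vE) (hyp_a p)) (exI _ _ _ vF v0).
  by rewrite ltxx.
have sumT p : (ES p + FS p = fullv)%VS.
  apply/eqP; rewrite eqEdim subvf dimv_disjoint_sum // dimE dimF dimvf /dim /= mul1n.
  (* The subtraction m - d - 1 is not truncated, since F_p is a subspace of T_pM. *)
  have : (d.+1 <= m)%N.
    rewrite -(dimF p) -[m in leqRHS]mul1n.
    by rewrite -[X in (_ <= X)%N](dimvf 'rV[R]_m) dimvS ?subvf.
  by move=> dm; rewrite -subnDA addn1 subnK.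
have ES_growth p : exists c, forall v, v \in ES p <-> growth g Phi 1 c (iota p) v.
  have [c [c' [sc cc' ci]]] := ereal_lt_between2 (hyp_a p).
  exists (2 * c); apply: splitting_growth (sumT p).
  - by move=> a u v; exact: growth_lincomb.
  - by move=> v vE; apply: forward_lt_growth => //; exact: le_lt_trans (exE _ _ _ vE) sc.
  - move=> v vF gv; apply/eqP; apply: contraT => v0.
    have := lt_le_trans ci (exI _ _ _ vF v0).
    by rewrite ltNge (growth_forward_le (Sc p) v0 cc' gv).
have FS_growth p : exists c, forall v, v \in FS p <-> growth g Phi (-1) c (iota p) v.
  have [c [c' [sc cc' ci]]] := ereal_lt_between2 (hyp_b p).
  have sumT' : (FS p + ES p = fullv)%VS by rewrite addvC.
  exists (2 * c); apply: splitting_growth sumT'.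
  - by move=> a u v; exact: growth_lincomb.
  - by move=> v vF; apply: backward_lt_growth => //; exact: le_lt_trans (exE _ _ _ vF) sc.
  - move=> v vE gv; apply/eqP; apply: contraT => v0.
    have := lt_le_trans ci (exI _ _ _ vE v0).
    by rewrite ltNge (growth_backward_le (Sc p) v0 cc' gv).
(* An orbit that returns to S carries the fibre of ES to the fibre of ES. *)
have [E EE] : exists E, flow_extension Phi iota ES E.
  apply: flow_extension_exists => // r p q rpq.
  have [c cP] := ES_growth p; have [c' c'P] := ES_growth q.
  rewrite -rpq in c'P; apply: growth_transport (mulr1 1) (Sc p) _ cP c'P.
  exact: etrans (dimE p) (esym (dimE q)).
have [F FE] : exists F, flow_extension Phi iota FS F.
  apply: flow_extension_exists => // r p q rpq.
  have [c cP] := FS_growth p; have [c' c'P] := FS_growth q.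
  rewrite -rpq in c'P.
  apply: growth_transport (etrans (mulrNN 1 1) (mulr1 1)) (Sc p) _ cP c'P.
  exact: etrans (dimF p) (esym (dimF q)).
split; first exact: flowout_is_immersion.
exists E, F; split.
  split.
  - split.
      by exists (m - d - 1)%N; apply: flow_extension_continuous EE.
    by exists d.+1; apply: flow_extension_continuous FE.
  - by split; apply: flow_extension_invariant; [|exact: EE| |exact: FE].
  - exact: flow_extension_restr EE.
  - exact: flow_extension_restr FE.
  - have D12 p := conj (cap0 p) (sumT p).
    exact: (flow_extension_split Sc EE FE D12).
move=> E' F' [_ [E'inv F'inv] E'S F'S _] x xN.
by rewrite (flow_extension_unique EE E'S E'inv) // (flow_extension_unique FE F'S F'inv).
Qed.
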